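(* Every structurally bounded expansion class of graphs is weakly $\chi_p$-bounded for every positive integer $p$.
   Context: All graphs are finite, simple and undirected. A shallow minor of $G$ at depth $r$ is a graph obtained from a subgraph of $G$ by contracting pairwise vertex-disjoint connected subgraphs of radius at most $r$. A class has bounded expansion if there is a function $g$ such that for every $r$, all shallow minors at depth $r$ of graphs in the class have average degree at most $g(r)$. A first-order transduction is a pair $\mathsf T=(\eta(x,y),\nu(x))$ of first-order formulas in the language of vertex-colored graphs (the adjacency relation together with finitely many unary predicates for colors), with $\eta$ symmetric. A class $\mathscr D$ is a first-order transduction of a class $\mathscr C$ if there is a first-order transduction $\mathsf T=(\eta,\nu)$ such that for every $G\in\mathscr D$ there are $H\in\mathscr C$ and a vertex-coloring $H^+$ of $H$ such that $V(G)$ is the set of vertices of $H$ satisfying $\nu$ in $H^+$, and $E(G)$ is the set of pairs of distinct vertices $u,v\in V(G)$ with $H^+\models\eta(u,v)$. A class has structurally bounded expansion if it is a first-order transduction of a class with bounded expansion. $\omega$ is the clique number; for a class $\mathscr D$, $\omega(\mathscr D)=\sup_{G\in\mathscr D}\omega(G)$. ${\rm TM}_r(G)$ is the class of all graphs $H$ such that some graph obtained from $H$ by subdividing each edge by at most $r$ vertices is a subgraph of $G$. The tree-depth ${\rm td}(G)$ is the minimum height (number of vertices on a longest root-to-leaf path) of a rooted forest $Y$ such that $G$ is a subgraph of the closure of $Y$ (the graph in which each vertex is adjacent to all its ancestors in $Y$). $\chi_p(G)$ is the minimum number of colors in a vertex coloring of $G$ such that every set $I$ of at most $p$ colors induces a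 subgraph of tree-depth at most $|I|$. A class $\mathscr C$ is weakly $\chi_p$-bounded if there is a function $g_p$ with $\chi_p(G)\leq g_p(\omega({\rm TM}_{p-1}(G)))$ for every $G\in\mathscr C$. *)

(* Defs.v *)
From HB Require Import structures.
From mathcomp Require Import all_boot all_order all_algebra.
From mathcomp Require Import boolp classical_sets.

Set Implicit Arguments.
Unset Strict Implicit.
Unset Printing Implicit Defensive.

Import Order.TTheory GRing.Theory Num.Theory.

Local Open Scope classical_set_scope.

Record sgraph := SGraph {
  vertex :> finType;
  sedge : rel vertex;
  sedge_sym : symmetric sedge;
  sedge_irr : irreflexive sedge }.

(* Classes need not be closed under isomorphism: the constructions below compare
   graphs up to isomorphism. ([set sgraph] would be universe-inconsistent.) *)
Definition graph_class := sgraph -> Prop.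

Definition subgraph (H G : sgraph) : Prop :=
  exists f : H -> G, injective f /\ (forall u v, sedge u v -> sedge (f u) (f v)).

Definition isomorphic (G H : sgraph) : Prop :=
  exists f : G -> H, bijective f /\ (forall u v, sedge (f u) (f v) = sedge u v).

Section Induced.
Variables (G : sgraph) (A : {set G}).

Definition induced_edge : rel {x : G | x \in A} :=
  fun x y => sedge (val x) (val y).

Lemma induced_sym : symmetric induced_edge.
Proof. by move=> x y; rewrite /induced_edge sedge_sym. Qed.

Lemma induced_irr : irreflexive induced_edge.
Proof. by move=> x; rewrite /induced_edge sedge_irr. Qed.

Definition induced : sgraph := SGraph induced_sym induced_irr.

End Induced.

(* Having radius at most r entails being nonempty and connected. *)
Definition radius_le (G : sgraph) (r : nat) : Prop :=
  exists c : G, forall x : G, exists s : seq G,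
    [/\ path (@sedge G) c s, last c s = x & size s <= r].

(* The map f contracts each of its fibers to one vertex. Vertices that are not
   contracted are the singleton fibers, of radius 0; contracting a connected
   subgraph has the same effect as contracting the subgraph induced on its
   vertex set, whose radius is not larger. *)
Definition contraction (r : nat) (G H : sgraph) : Prop :=
  exists f : G -> H,
    (forall h : H, radius_le (induced [set x | f x == h]%SET) r) /\
    (forall a b : H, sedge a b <->
       a != b /\ exists x y : G, [/\ f x = a, f y = b & sedge x y]).

Definition shallow_minor (r : nat) (H G : sgraph) : Prop :=
  exists G' : sgraph, subgraph G' G /\ contraction r G' H.

(* The sum of degrees divided by the order, and 0 for the empty graph. *)
Definition average_degree (G : sgraph) : rat :=
  ((\sum_(x : G) #|[set y | sedge x y]%SET|)%:R / #|G|%:R)%R.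

Definition bounded_expansion (C : graph_class) : Prop :=
  exists g : nat -> rat, forall (r : nat) (G H : sgraph),
    C G -> shallow_minor r H G -> (average_degree H <= g r)%R.

(* First-order formulas over graphs with k unary predicates, whose free
   variables are indexed by 'I_n. In [FExists f], variable 0 of f is the bound
   one and variable i.+1 of f is variable i outside. *)
Inductive formula (k : nat) : nat -> Type :=
| FEq n (i j : 'I_n) : formula k n
| FAdj n (i j : 'I_n) : formula k n
| FColor n (c : 'I_k) (i : 'I_n) : formula k n
| FNot n (f : formula k n) : formula k n
| FAnd n (f g : formula k n) : formula k n
| FExists n (f : formula k n.+1) : formula k n.

(* The interpretation of the unary predicates is arbitrary: a vertex may carry
   several colors, or none. *)
Definition coloring (k : nat) (G : sgraph) := 'I_k -> {set G}.

Fixpoint holds (k : nat) (G : sgraph) (M : coloring k G) (n : nat)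
    (f : formula k n) : n.-tuple G -> bool :=
  match f in formula _ n return n.-tuple G -> bool with
  | FEq _ i j => fun e => tnth e i == tnth e j
  | FAdj _ i j => fun e => sedge (tnth e i) (tnth e j)
  | FColor _ c i => fun e => tnth e i \in M c
  | FNot _ f => fun e => ~~ holds M f e
  | FAnd _ f g => fun e => holds M f e && holds M g e
  | FExists _ f => fun e => [exists x : G, holds M f [tuple of x :: e]]
  end.

Record transduction := Transduction {
  ncolors : nat;
  eta : formula ncolors 2;
  nu : formula ncolors 1;
  eta_sym : forall (H : sgraph) (M : coloring ncolors H) (u v : H),
    holds M eta [tuple u; v] = holds M eta [tuple v; u] }.

Section Interpretation.
Variables (T : transduction) (H : sgraph) (M : coloring (ncolors T) H).

Definition transduced_edge : rel {x : H | holds M (nu T) [tuple x]} :=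
  fun u v => (u != v) && holds M (eta T) [tuple val u; val v].

Lemma transduced_sym : symmetric transduced_edge.
Proof. by move=> u v; rewrite /transduced_edge eq_sym eta_sym. Qed.

Lemma transduced_irr : irreflexive transduced_edge.
Proof. by move=> u; rewrite /transduced_edge eqxx. Qed.

Definition transduced : sgraph := SGraph transduced_sym transduced_irr.

End Interpretation.

Definition transduction_of (D C : graph_class) : Prop :=
  exists T : transduction, forall G : sgraph, D G ->
    exists (H : sgraph) (M : coloring (ncolors T) H),
      C H /\ isomorphic G (transduced M).

Definition structurally_bounded_expansion (D : graph_class) : Prop :=
  exists C : graph_class, bounded_expansion C /\ transduction_of D C.

Definition clique (G : sgraph) (A : {set G}) : bool :=
  [forall x in A, forall y in A, (x != y) ==> sedge x y].

Definition omega (G : sgraph) : nat := \max_(A : {set G} | clique A) #|A|.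

(* The supremum in nat; it is 0 by convention when the clique numbers are
   unbounded, which does not happen for the classes [TM r G] below, see
   [TM_omega_le]. *)
Definition omega_class (D : graph_class) : nat := 
  supremum 0 [set n | exists2 G : sgraph, D G & omega G = n].

(* The edge uv of H, oriented so that u comes before v in the enumeration of the
   vertices, is replaced by the path u, (u,v,0), ..., (u,v,l u v - 1), v. Only
   the values of l on so oriented edges matter. *)
Section Subdivision.
Variables (H : sgraph) (r : nat) (l : H -> H -> 'I_r.+1).

Definition oriented_edge (u v : H) : bool :=
  sedge u v && (enum_rank u < enum_rank v).

Definition subdivision_vertex : finType :=
  (H + {t : H * H * 'I_r |
          oriented_edge t.1.1 t.1.2 && (t.2 < l t.1.1 t.1.2)})%type.

Definition subdivision_arc (x y : subdivision_vertex) : bool :=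
  match x, y with
  | inl u, inl v => oriented_edge u v && (l u v == 0 :> nat)
  | inl u, inr t => ((val t).1.1 == u) && ((val t).2 == 0 :> nat)
  | inr s, inr t => ((val s).1 == (val t).1) && ((val t).2 == (val s).2.+1 :> nat)
  | inr t, inl v =>
      ((val t).1.2 == v) && ((val t).2.+1 == l (val t).1.1 (val t).1.2 :> nat)
  end.

Definition subdivision_edge : rel subdivision_vertex :=
  fun x y => subdivision_arc x y || subdivision_arc y x.

Lemma subdivision_sym : symmetric subdivision_edge.
Proof. by move=> x y; rewrite /subdivision_edge orbC. Qed.

Lemma subdivision_irr : irreflexive subdivision_edge.
Proof.
move=> x; rewrite /subdivision_edge orbb; case: x => [u|t] /=.
  by rewrite /oriented_edge ltnn andbF.
by rewrite eqxx /= ltn_eqF.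
Qed.

Definition subdivision : sgraph := SGraph subdivision_sym subdivision_irr.

End Subdivision.

Definition TM (r : nat) (G : sgraph) : graph_class :=
  fun H => exists l : H -> H -> 'I_r.+1, subgraph (subdivision l) G.

(* Rooted forests, given by the partial parent function; the roots are the
   vertices without parent. *)
Section ForestOrder.
Variables (V : finType) (parent : V -> option V).

(* y is x or an ancestor of x *)
Definition ancestor_or_self (x y : V) : bool :=
  connect (fun a b => parent a == Some b) x y.

Definition leaf (x : V) : bool := [forall y, parent y != Some x].

End ForestOrder.

Record rooted_forest := RootedForest {
  fvertex :> finType;
  parent : fvertex -> option fvertex;
  parent_acyclic : forall x y,
    parent x = Some y -> ~~ ancestor_or_self parent y x }.

(* The path from the root to x consists of x and its ancestors. *)
Definition height (Y : rooted_forest) : nat :=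
  \max_(x : Y | leaf (@parent Y) x)
     #|[set y | ancestor_or_self (@parent Y) x y]%SET|.

Section Closure.
Variable Y : rooted_forest.

Definition closure_edge : rel Y := fun x y =>
  (x != y) && (ancestor_or_self (@parent Y) x y
               || ancestor_or_self (@parent Y) y x).

Lemma closure_sym : symmetric closure_edge.
Proof. by move=> x y; rewrite /closure_edge eq_sym orbC. Qed.

Lemma closure_irr : irreflexive closure_edge.
Proof. by move=> x; rewrite /closure_edge eqxx. Qed.

Definition forest_closure : sgraph := SGraph closure_sym closure_irr.

End Closure.

(* The infima in [treedepth] and [chi] are minima, see [treedepth_attained] and
   [chi_attained]. *)
Definition treedepth (G : sgraph) : nat :=
  infimum 0
    [set n | exists2 Y : rooted_forest,
       subgraph G (forest_closure Y) & height Y = n].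

Definition chi_coloring (p : nat) (G : sgraph) (k : nat) (c : G -> 'I_k) : Prop :=
  forall I : {set 'I_k}, #|I| <= p ->
    treedepth (induced [set x | c x \in I]%SET) <= #|I|.

Definition chi (p : nat) (G : sgraph) : nat :=
  infimum 0 [set k | exists c : G -> 'I_k, chi_coloring p c].

Definition weakly_chi_bounded (p : nat) (C : graph_class) : Prop :=
  exists g : nat -> nat, forall G : sgraph,
    C G -> chi p G <= g (omega_class (TM p.-1 G)).

Lemma TM_omega_le (r : nat) (G H : sgraph) : TM r G H -> omega H <= #|G|.
Proof.
move=> [l [f [finj _]]]; apply/bigmax_leqP => A _.
apply: leq_trans (max_card _) _.
by apply: (@leq_card _ _ (fun u : H => f (inl u))) => u v /finj [].
Qed.

Lemma nat_infimumP (A : set nat) :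
  A !=set0 -> A (infimum 0 A) /\ forall n, A n -> infimum 0 A <= n.
Proof.
case=> n An; have exA : exists n, `[< A n >] by exists n; apply/asboolP.
case: (ex_minnP exA) => m /asboolP Am mP.
have mlb x : A x -> m <= x by move=> Ax; apply: mP; apply/asboolP.
have Im : infimums A m by split=> [x /mlb|x]; [|apply].
suff -> : infimum 0 A = m by [].
rewrite /infimum; case: ifPn => [/eqP A0|_]; first by move: An; rewrite A0.
by case: xgetP => [x _ xI|/(_ m)//]; exact: (is_subset1_infimums xI Im).
Qed.

Section Chain.
Variable n : nat.

Definition chain_parent (i : 'I_n) : option 'I_n :=
  [pick j : 'I_n | j.+1 == i :> nat].

Lemma chain_ancestor_le (i j : 'I_n) : ancestor_or_self chain_parent i j -> j <= i.
Proof.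
case/connectP => s; elim: s i => [|k s IH] i /=; first by move=> _ ->.
case/andP; rewrite /chain_parent; case: pickP => // k' /eqP ki /eqP [<-] ps lj.
by apply: leq_trans (IH _ ps lj) _; rewrite -ki leqnSn.
Qed.

Lemma chain_acyclic (i j : 'I_n) :
  chain_parent i = Some j -> ~~ ancestor_or_self chain_parent j i.
Proof.
rewrite /chain_parent; case: pickP => // k /eqP ki [<-].
by apply/negP => /chain_ancestor_le; rewrite -ki ltnn.
Qed.

Definition chain : rooted_forest := RootedForest chain_acyclic.

Lemma chain_ancestor (i j : 'I_n) : j <= i -> ancestor_or_self chain_parent i j.
Proof.
move: {2}(i : nat) (erefl (i : nat)) => m; elim: m i => [|m IH] i im ji.
  by rewrite (_ : j = i); [exact: connect0|apply/val_inj/eqP; move: ji; rewrite im leqn0 /= im].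
have [/eqP ij|ij] := boolP (j == i); first by rewrite ij; exact: connect0.
have mn : m < n by apply: ltn_trans (ltn_ord i); rewrite im.
apply: (@connect_trans _ _ (Ordinal mn)).
  apply: connect1; rewrite /chain_parent; case: pickP => [k /eqP ki|/(_ (Ordinal mn))].
    by apply/eqP; congr Some; apply/val_inj => /=; move: ki; rewrite im => -[].
  by rewrite /= im eqxx.
by apply: IH => //=; rewrite -ltnS -im ltn_neqAle ji -val_eqE in ij *; rewrite ij.
Qed.

End Chain.

Lemma subgraph_chain (G : sgraph) : subgraph G (forest_closure (chain #|G|)).
Proof.
exists (@enum_rank G); split; first exact: enum_rank_inj.
move=> u v uv; apply/andP; split.
  by rewrite (inj_eq enum_rank_inj); apply: contraTneq uv => ->; rewrite sedge_irr.
by apply/orP; case: (leqP (enum_rank v) (enum_rank u)) => [|/ltnW] h;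
  [left|right]; apply: chain_ancestor.
Qed.

Lemma chain_height n : height (chain n) <= n.
Proof.
by apply/bigmax_leqP => x _; rewrite -[leqRHS](card_ord n) max_card.
Qed.

Lemma treedepth_attained (G : sgraph) :
  (exists Y : rooted_forest, subgraph G (forest_closure Y) /\ height Y = treedepth G)
  /\ (forall Y : rooted_forest,
        subgraph G (forest_closure Y) -> treedepth G <= height Y).
Proof.
have [|[Y GY hY] mG] := @nat_infimumP [set n | exists2 Y : rooted_forest,
    subgraph G (forest_closure Y) & height Y = n].
  by exists (height (chain #|G|)), (chain #|G|) => //; exact: subgraph_chain.
by split; [exists Y | move=> Z GZ; apply: mG; exists Z].
Qed.

Lemma chi_attained (p : nat) (G : sgraph) :
  (exists c : G -> 'I_(chi p G), chi_coloring p c)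
  /\ (forall k (c : G -> 'I_k), chi_coloring p c -> chi p G <= k).
Proof.
have [|cG mG] := @nat_infimumP [set k | exists c : G -> 'I_k, chi_coloring p c].
  exists #|G|, (@enum_rank G) => I _; set J := induced _.
  have [_ /(_ _ (@subgraph_chain J)) tJ] := treedepth_attained J.
  apply: leq_trans tJ (leq_trans (chain_height _) _).
  have [f finj fI] : exists2 f : J -> 'I_#|G|, injective f & forall x, f x \in I.
    exists (fun x => enum_rank (val x)) => [x y /enum_rank_inj /val_inj //|x].
    by have := valP x; rewrite inE.
  rewrite -(card_imset _ finj); apply/subset_leq_card/fintype.subsetP.
  by move=> _ /imsetP[x _ ->].
by split=> // k c ck; apply: mG; exists c.
Qed.

(* Main.v *)
(** The source graph H of the transduction is ordered so that the sets R(v) of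
    vertices weakly r-reachable from v are bounded, and receives a colouring a
    in which v differs from every vertex weakly m-reachable from it, m >> r.
    Every walk of length at most r from u to v meets R(u) ∩ R(v), so by the
    locality of first-order logic an edge uv of the transduced graph depends only
    on labels of u and v taken from a fixed finite set, and on the colours of
    R(u) ∩ R(v).
    Colour v by the set of a-colours of R(v). The vertices of p such colours use
    a bounded number of a-colours in total, so a is centered there: removing the
    uniquely coloured vertices one after the other exhibits a tree-model of
    bounded depth, i.e. bounded shrub-depth. A graph of bounded shrub-depth has
    bounded chromatic number if it has no large clique (case p = 1), and bounded
    tree-depth if it has no large biclique. For p >= 2 a large biclique contains
    a 1-subdivision of a large complete graph. *)

Require Import Defs.
From mathcomp Require Import all_boot all_order all_algebra zify.
From mathcomp Require Import boolp.
From mathcomp Require classical_sets.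

Set Implicit Arguments.
Unset Strict Implicit.
Unset Printing Implicit Defensive.

(** * Walks and shallow minors *)

(** A single order must serve two radii, the larger of which is exponential in the bound obtained
    for the smaller. This is not circular: the bounds depend only on the class and the radius, never
    on the order, and in every nonempty vertex set the vertices unsuitable for a given radius are
    fewer than half, so one vertex suits both radii and can be placed last. The smaller radius comes
    from the formula alone; it must not grow with the number of deleted vertices, since that number
    is bounded only once the radius is known. The case [p = 1] stands apart because [TM 0] contains
    only subgraphs: cliques are then excluded but large bicliques are not, so tree-depth may be
    unbounded and only a proper colouring is available. For [p >= 2] a bounded number of ranks is
    not enough, since the tree-depth must not exceed the number of colours present; the final colour
    therefore records ranks for every set of cover colours. *)

Section Walk.
Variable H : sgraph.
Implicit Types (P Q : pred H) (x y z : H) (n : nat).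

Definition walk P n x y : Prop :=
  exists s, [/\ path (@sedge H) x s, last x s = y, size s <= n & all P (x :: s)].

Lemma walk0 P n x : P x -> walk P n x x.
Proof. by move=> Px; exists [::]; rewrite /= Px. Qed.

Lemma walk_sub P Q n n' x y :
  (forall z, P z -> Q z) -> n <= n' -> walk P n x y -> walk Q n' x y.
Proof.
move=> PQ nn [s [ps ls ss As]]; exists s; split=> //; first exact: leq_trans nn.
exact: sub_all As.
Qed.

Lemma walk_cat P n n' x y z : walk P n x y -> walk P n' y z -> walk P (n + n') x z.
Proof.
move=> [s [ps ls ss As]] [t [pt lt st At]]; exists (s ++ t); split.
- by rewrite cat_path ps ls.
- by rewrite last_cat ls.
- by rewrite size_cat leq_add.
- by move: As At; rewrite /= all_cat => /andP[-> ->] /andP[_ ->].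
Qed.

Lemma walk_sym P n x y : walk P n x y -> walk P n y x.
Proof.
move=> [s [ps ls ss As]]; exists (rev (belast x s)).
have Al : all P (y :: rev (belast x s)) by rewrite -ls -rev_rcons -lastI all_rev.
split=> //.
- by rewrite -ls rev_path; under eq_path do rewrite sedge_sym.
- by case: s {ps ss As Al} ls => [|a s] /= => [->|_] //; rewrite rev_cons last_rcons.
- by rewrite size_rev size_belast.
Qed.

Lemma walk_end P n x y : walk P n x y -> P y.
Proof.
by move=> [s [_ <- _ As]]; apply: (allP As); rewrite mem_last.
Qed.

Lemma walk_start P n x y : walk P n x y -> P x.
Proof. by move/walk_sym/walk_end. Qed.

Lemma path_walk P s1 s2 x y :
  path (@sedge H) x (rcons s1 y ++ s2) -> all P (x :: rcons s1 y) ->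
  walk P (size (rcons s1 y ++ s2)) x y.
Proof.
rewrite cat_path => /andP[ps _] As; exists (rcons s1 y); split=> //.
  by rewrite last_rcons.
by rewrite size_cat leq_addr.
Qed.

End Walk.

Section Clusters.
Variable H : sgraph.

(** Disjoint clusters are kept as a partial map into [H] itself, each vertex sent to its center, so
    that clusters can be enlarged or regrouped without building new graphs. *)
Definition cluster_map (r : nat) (f : H -> option H) : Prop :=
  forall x i, f x = Some i -> walk (fun y => f y == Some i) r i x.

Definition centers (f : H -> option H) : {set H} := [set i | f i == Some i].

Definition cadj (f : H -> option H) : rel H := fun i j =>
  (i != j) && [exists x, exists y, [&& f x == Some i, f y == Some j & sedge x y]].

Definition cdeg f i := #|[set j | cadj f i j]|.

Lemma cadjP f i j : reflect (i <> j /\ exists x y, [/\ f x = Some i, f y = Some j & sedge x y])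
  (cadj f i j).
Proof.
apply: (iffP andP) => [[/eqP ij /existsP[x /existsP[y /and3P[/eqP fx /eqP fy xy]]]]|].
  by split=> //; exists x, y.
move=> [/eqP ij [x [y [fx fy xy]]]]; split=> //; apply/existsP; exists x.
by apply/existsP; exists y; rewrite fx fy !eqxx.
Qed.

Lemma cadj_sym f : symmetric (cadj f).
Proof.
by move=> i j; apply/cadjP/cadjP => -[/nesym ij [x [y [fx fy xy]]]]; split=> //;
  exists y, x; rewrite sedge_sym.
Qed.

Lemma cluster_center r f x i : cluster_map r f -> f x = Some i -> f i = Some i.
Proof. by move=> cf /cf /walk_start /eqP. Qed.

Lemma cadj_center r f i j : cluster_map r f -> cadj f i j -> f i = Some i /\ f j = Some j.
Proof.
by move=> cf /cadjP[_ [x [y [/(cluster_center cf) -> /(cluster_center cf) ->]]]].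
Qed.

End Clusters.

Definition sparse (d : nat -> nat) (H : sgraph) : Prop :=
  forall r f, cluster_map r f -> \sum_(i in @centers H f) cdeg f i <= d r * #|centers f|.

Section ClusterMinor.
Variables (H : sgraph) (r : nat) (f : H -> option H).
Hypothesis cf : cluster_map r f.

Let V := {i : H | i \in centers f}.

Let medge : rel V := fun i j => cadj f (val i) (val j).

Let medge_sym : symmetric medge.
Proof. by move=> i j; rewrite /medge cadj_sym. Qed.

Let medge_irr : irreflexive medge.
Proof. by move=> i; rewrite /medge /cadj eqxx. Qed.

Definition cluster_minor : sgraph := SGraph medge_sym medge_irr.

Let D : {set H} := [set x | f x != None].

Let proj_subproof (x : H) : x \in D -> odflt x (f x) \in centers f.
Proof.
rewrite !inE; case E: (f x) => [i|] //= _; apply/eqP.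
exact: cluster_center cf E.
Qed.

Let proj (x : induced D) : cluster_minor := Sub (odflt (val x) (f (val x))) (proj_subproof (valP x)).

Let projE (x : induced D) (i : V) : (proj x == i) = (f (val x) == Some (val i)).
Proof.
rewrite -val_eqE /=; have := valP x; rewrite inE.
by case: (f (val x)).
Qed.

Lemma cluster_minor_shallow : shallow_minor r cluster_minor H.
Proof.
exists (induced D); split; first by exists val; split=> //; exact: val_inj.
exists proj; split=> [i|i j].
  have ic : f (val i) = Some (val i) by have := valP i; rewrite inE => /eqP.
  have iD : val i \in D by rewrite inE ic.
  have ii : (Sub (val i) iD : induced D) \in [set x | proj x == i].
    by rewrite inE projE /= ic.
  exists (Sub (Sub (val i) iD : induced D) ii) => x.
  have := valP x; rewrite inE projE => /eqP /cf [s [ps ls ss As]].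
  (* A walk inside a fiber is pulled back through the two nested subtypes. *)
  have lift : forall (s : seq H) (y : induced [set x | proj x == i]),
      path (@sedge H) (val (val y)) s -> all (fun y => f y == Some (val i)) s ->
      exists t : seq (induced [set x | proj x == i]),
        path (@sedge (induced [set x | proj x == i])) y t /\ map (fun z => val (val z)) t = s.
    elim=> [|a u IH] y /=; first by exists [::].
    case/andP=> ya pu /andP[fa fu].
    have aD : a \in D by rewrite inE (eqP fa).
    have ai : (Sub a aD : induced D) \in [set x | proj x == i] by rewrite inE projE.
    have [t [pt mt]] := IH (Sub (Sub a aD : induced D) ai) pu fu.
    exists (Sub (Sub a aD : induced D) ai :: t); rewrite /= pt mt; split=> //.
    by rewrite andbT.
  case/andP: As => _ As.
  have [t [pt mt]] := lift s (Sub (Sub (val i) iD : induced D) ii) ps As.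
  exists t; split=> //; last by rewrite -(size_map (fun z => val (val z))) mt.
  apply/val_inj/val_inj; rewrite -ls -mt.
  by rewrite (last_map (fun z => val (val z)) t (Sub (Sub (val i) iD : induced D) ii)).
split=> [/cadjP[ij [x [y [fx fy xy]]]]|[/eqP ij [x [y [/eqP fx /eqP fy xy]]]]].
  have xD : x \in D by rewrite inE fx.
  have yD : y \in D by rewrite inE fy.
  split; first by apply/eqP => ij'; apply: ij; rewrite ij'.
  by exists (Sub x xD : induced D), (Sub y yD : induced D); split=> //; apply/eqP; rewrite projE /= ?fx ?fy.
apply/cadjP; split; first by move/val_inj.
exists (val x), (val y); split=> //.
  by apply/eqP; rewrite -projE.
by apply/eqP; rewrite -projE.
Qed.

Lemma cluster_minor_avg (d : nat) : (average_degree cluster_minor <= d%:R)%R ->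
  \sum_(i in centers f) cdeg f i <= d * #|centers f|.
Proof.
have -> : \sum_(i in centers f) cdeg f i = \sum_(x : cluster_minor) #|[set y | sedge x y]|.
  rewrite big_sub; apply: eq_bigr => i _.
  rewrite -(card_imset _ (@val_inj _ _ V)); apply: eq_card => j; rewrite inE.
  apply/idP/imsetP => [ij|[j' + ->]]; last by rewrite inE.
  have [_ jc] := cadj_center cf ij.
  have jc' : j \in centers f by rewrite inE jc.
  by exists (Sub j jc' : V) => //; rewrite inE.
have cV : #|cluster_minor| = #|centers f| by rewrite card_sig.
have [c0 _|c0] := posnP #|centers f|.
  by rewrite big1 // => i; case: (fintype0 i); rewrite cV.
rewrite /average_degree cV.
by rewrite Num.Theory.ler_pdivrMr ?Num.Theory.ltr0n // -GRing.natrM Num.Theory.ler_nat.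
Qed.

End ClusterMinor.

Lemma bounded_expansion_sparse (C : graph_class) :
  bounded_expansion C -> exists d, forall H, C H -> sparse d H.
Proof.
(* The maximum with 0 supplies the nonnegativity required by the Archimedean bound. *)
move=> [g gP]; exists (fun r => Num.Def.archi_bound (Num.max (g r) 0)%R) => H CH r f cf.
apply: (cluster_minor_avg cf); apply: Order.POrderTheory.le_trans (gP r H _ CH (cluster_minor_shallow cf)) _.
apply: (@Order.POrderTheory.le_trans _ _ (Num.max (g r) 0)%R).
  by rewrite Order.TotalTheory.le_max Order.POrderTheory.lexx.
apply/Order.POrderTheory.ltW/Num.Theory.archi_boundP.
by rewrite Order.TotalTheory.le_max Order.POrderTheory.lexx orbT.
Qed.

(** * Orders with bounded weak reachability *)

Section BadSet.
Variables (H : sgraph) (m : nat).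

(* The start v of the walk does not count as a hit. *)
Definition hits (N : nat) (v : H) (S : {set H}) : Prop :=
  exists2 F : {set H}, #|F| <= N &
    forall s, path (@sedge H) v s -> size s <= m -> last v s \in S :\ v -> has (mem F) s.

Variable S : {set H}.

Definition dom (f : H -> option H) : {set H} := [set x | f x != None].

Definition nadj (f : H -> option H) := #|[set p : H * H | cadj f p.1 p.2]|.

(* The bound on the domain holds as long as each adjacency of clusters was paid
   for by the vertices of one walk of length at most m + m. *)
Definition admissible (f : H -> option H) : Prop :=
  [/\ cluster_map (m + m) f, centers f = S & #|dom f| <= #|S| + (m + m) * nadj f].

Lemma nadjE f r : cluster_map r f -> nadj f = \sum_(i in centers f) cdeg f i.
Proof.
move=> cf; rewrite /nadj -sum1_card (eq_bigl (fun p => (p.1 \in centers f) && (p.2 \in [set j | cadj f p.1 j]))).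
  by rewrite -(pair_big_dep (mem (centers f)) (fun i j => j \in [set j | cadj f i j]) (fun _ _ => 1)) /=;
   apply: eq_bigr => i _; rewrite sum1_card.
move=> [i j]; rewrite !inE /=; apply/idP/andP => [ij|[_ ->]//].
by have [-> _] := cadj_center cf ij.
Qed.

Lemma admissible_self : admissible (fun x => if x \in S then Some x else None).
Proof.
split.
- move=> x i; case: ifP => // xS [<-]; by apply: walk0; rewrite xS eqxx.
- by apply/setP => i; rewrite !inE; case: (i \in S); rewrite ?eqxx.
- apply: leq_trans (leq_addr _ _); apply: subset_leq_card; apply/subsetP => x.
  by rewrite inE; case: (x \in S).
Qed.

Definition graft (f : H -> option H) v (s : seq H) x :=
  if (x \in s) && (f x == None) then Some v else f x.

(** Before its end the walk meets only free vertices and [v]. They join the cluster of [v] along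
    prefixes of the walk, hence within radius [m + m]; this costs fewer than [m + m] vertices and
    gains the adjacency of [v] and [w]. *)
Lemma graft_admissible f v s w : admissible f -> v \in S -> w \in S -> v != w ->
  path (@sedge H) v (rcons s w) -> size s < m + m ->
  all (fun x => (f x == None) || (x == v)) s -> ~~ cadj f v w ->
  admissible (graft f v s) /\ nadj f < nadj (graft f v s).
Proof.
move=> [cf ce dS] vS wS vw ps ss As nvw; set f' := graft f v s.
have fS x : x \in S -> f x = Some x by rewrite -ce inE => /eqP.
have ff x i : f x = Some i -> f' x = Some i by rewrite /f' /graft => ->; rewrite andbF.
have f's x : x \in s -> f' x = Some v.
  move=> xs; rewrite /f' /graft xs; case: ifP => //= fx.
  by have := allP As x xs; rewrite fx /= => /eqP ->; exact: fS.
have cf' : cluster_map (m + m) f'.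
  move=> x i; rewrite {1}/f' /graft; case: ifP => [/andP[xs fx] [<-]|_ /cf fx].
    case/splitPr: xs ps ss f's => s1 s2 ps ss f's.
    apply: (@walk_sub _ (fun y => f' y == Some v) _ (size (rcons s1 x ++ rcons s2 w))) => //.
      by move: ss; rewrite !size_cat !size_rcons /=; lia.
    apply: path_walk; first by move: ps; rewrite -cats1 -catA cat_cons cats1 cat_rcons.
    rewrite /= (ff v v (fS v vS)) eqxx /=; apply/allP => y; rewrite mem_rcons => ys.
    by apply/eqP/f's; rewrite mem_cat; move: ys; rewrite !inE => /orP[->|->]; rewrite ?orbT.
  by apply: walk_sub fx => // y /eqP /ff /eqP.
have cadj_sub i j : cadj f i j -> cadj f' i j.
  by move=> /cadjP[ij [x [y [/ff fx /ff fy xy]]]]; apply/cadjP; split=> //; exists x, y.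
have lt : nadj f < nadj f'.
  apply: proper_card; apply/properP; split.
    by apply/subsetP => -[i j]; rewrite !inE; exact: cadj_sub.
  exists (v, w); rewrite !inE //=; apply/cadjP; split; first exact/eqP.
  exists (last v s), w; split; last by move: ps; rewrite rcons_path => /andP[].
    by have := mem_last v s; rewrite inE => /orP[/eqP ->|/f's //]; exact/ff/fS.
  exact/ff/fS.
split=> //; split=> //.
  rewrite -ce; apply/setP => i; rewrite !inE; apply/eqP/eqP => [|/ff //].
  by rewrite {1}/f' /graft; case: ifP => [_ [<-]|//]; exact: fS.
have sub : dom f' \subset dom f :|: [set x in s].
  apply/subsetP => x; rewrite !inE /f' /graft; case: (x \in s); rewrite ?orbT //=.
  by move->.
apply: leq_trans (subset_leq_card sub) _; apply: leq_trans (leq_card_setU _ _) _.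
have : #|[set x in s]| <= size s by rewrite cardsE card_size.
nia.
Qed.

(** Maximality refers to [nadj]: a walk violating the conclusion, cut at its first visit to [w],
    could be grafted. *)
Lemma admissible_maximal : exists2 f, admissible f &
  forall v w n, walk (fun x => [|| f x == None, x == v | x == w]) n v w -> n <= m + m ->
    v \in S -> w \in S -> v != w -> cadj f v w.
Proof.
pose P (f : {ffun H -> option H}) := `[< admissible f >].
have P0 : P [ffun x => if x \in S then Some x else None].
  apply/asboolP; have := admissible_self; congr admissible.
  by apply/funext => x; rewrite ffunE.
case: (arg_maxnP (fun f : {ffun H -> option H} => nadj f) P0) => f /asboolP af fmax.
exists f => // v w n [s [ps ls ss As]] nm vS wS vw.
apply/negPn/negP => nvw.
have ws : w \in s.
  by have := mem_last v s; rewrite ls inE => /orP[/eqP wv|//]; rewrite wv eqxx in vw.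
have [s1 [s2 [es ws1]]] : exists s1 s2, s = rcons s1 w ++ s2 /\ w \notin s1.
  have hw : has (pred1 w) s by rewrite has_pred1.
  case: (split_find hw) ps => _ s1 s2 /eqP -> nh _; exists s1, s2; split=> //.
  by rewrite -has_pred1.
have ps1 : path (@sedge H) v (rcons s1 w) by move: ps; rewrite es cat_path => /andP[].
have [|| af' lt] := graft_admissible af vS wS vw ps1 _ _ nvw.
- by move: ss; rewrite es size_cat size_rcons; lia.
- apply/allP => x xs1; have := allP As x; rewrite es inE mem_cat mem_rcons inE xs1 !orbT /=.
  by move=> /(_ isT); case: (x =P w) => [xw|_]; [rewrite -xw xs1 in ws1|rewrite orbF].
have := fmax [ffun x => graft f v s1 x]; rewrite /P.
have -> : ([ffun x => graft f v s1 x] : H -> option H) = graft f v s1.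
  by apply/funext => x; rewrite ffunE.
by move=> /(_ (asboolT af')) le; have := leq_trans lt le; rewrite ltnn.
Qed.

End BadSet.

(** The closed neighbourhoods of the members of a maximal independent set cover [B]. *)
Lemma independent_subset (T : finType) (e : rel T) (B : {set T}) k :
  symmetric e -> {in B, forall v, #|[set w | e v w]| <= k} ->
  exists I : {set T}, [/\ I \subset B, {in I &, forall v w, ~~ e v w \/ v = w}
    & #|B| <= k.+1 * #|I|].
Proof.
move=> es dB.
pose P (I : {set T}) := (I \subset B) && [forall v in I, forall w in I, (v != w) ==> ~~ e v w].
have P0 : P set0 by rewrite /P sub0set; apply/forall_inP => v; rewrite inE.
have [I /maxsetP[/andP[IB Iind] Imax] _] := maxset_exists P0.
have Iind' v w : v \in I -> w \in I -> v != w -> ~~ e v w.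
  by move=> vI wI vw; have /forall_inP/(_ v vI)/forall_inP/(_ w wI)/implyP/(_ vw) := Iind.
exists I; split=> //.
  by move=> v w vI wI; have [->|vw] := eqVneq v w; [right|left; exact: Iind'].
have cov : B \subset \bigcup_(v in I) (v |: [set w | e v w]).
  apply/subsetP => x xB; apply/bigcupP; case: (boolP (x \in I)) => [xI|xI].
    by exists x => //; rewrite !inE eqxx.
  have [/existsP[v /andP[vI vx]]|/existsPn nx] := boolP [exists v, (v \in I) && e v x].
    by exists v => //; rewrite !inE vx orbT.
  suff E : x |: I = I by rewrite -E setU11 in xI.
  apply: Imax; last exact: subsetUr.
  rewrite /P subUset sub1set xB IB /=.
  have nx' v : v \in I -> ~~ e v x by move=> vI; have := nx v; rewrite vI.
  apply/forall_inP => v; rewrite !inE => /orP[/eqP ->|vI];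
  apply/forall_inP => w; rewrite !inE => /orP[/eqP ->|wI]; apply/implyP => vw.
  - by rewrite eqxx in vw.
  - by rewrite es; exact: nx'.
  - exact: nx'.
  - exact: Iind'.
apply: leq_trans (subset_leq_card cov) _.
apply: (@leq_trans (\sum_(v in I) k.+1)); last by rewrite sum_nat_const mulnC.
have sb : #|\bigcup_(v in I) (v |: [set w | e v w])| <= \sum_(v in I) #|v |: [set w | e v w]|.
  elim/big_rec2: _ => [|v n A _ IH]; first by rewrite cards0.
  by apply: leq_trans (leq_card_setU _ _) _; rewrite leq_add2l.
apply: leq_trans sb _; apply: leq_sum => v vI; apply: leq_trans (leq_card_setU _ _) _.
by rewrite cards1 ltnS; apply/dB/(subsetP IB).
Qed.

Lemma walk_prefix (H : sgraph) (P : pred H) n x y s1 s2 :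
  path (@sedge H) x (s1 ++ y :: s2) -> size (s1 ++ y :: s2) <= n -> all P (x :: s1) ->
  walk P n x (last x s1) /\ sedge (last x s1) y.
Proof.
rewrite cat_path /= => /and3P[ps ly _] sn As; split=> //; exists s1; split=> //.
by apply: leq_trans sn; rewrite size_cat leq_addr.
Qed.

Section Ball.
Variables (H : sgraph) (m : nat) (f : H -> option H) (I : {set H}).
Hypothesis fI : {in I, forall v, f v = Some v}.
Let Pb v := fun x : H => (f x == None) || (x == v).
Hypothesis disj : forall v w x, v \in I -> w \in I -> f x = None ->
  walk (Pb v) m v x -> walk (Pb w) m w x -> v = w.

(** The domain of [f] dissolves into singleton clusters, while free vertices join the ball of a
    member of [I]; [disj] makes the pick unambiguous. *)
Definition ball_map (x : H) : option H :=
  if f x == None then [pick v in I | `[< walk (Pb v) m v x >]] else Some x.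

Lemma ball_mapP v x : v \in I -> walk (Pb v) m v x -> ball_map x = Some v.
Proof.
move=> vI wx; rewrite /ball_map; have [fx|fx] := eqVneq (f x) None.
  case: pickP => [w /andP[wI /asboolP ww]|/(_ v)]; first by rewrite (disj vI wI fx wx ww).
  by rewrite vI asboolT.
by have := walk_end wx; rewrite /Pb (negbTE fx) => /eqP ->.
Qed.

Lemma ball_map_cluster : cluster_map m ball_map.
Proof.
move=> x i; rewrite {1}/ball_map; have [fx|fx] := eqVneq (f x) None; last first.
  move=> [<-]; apply: walk0; rewrite /ball_map (negbTE fx); exact: eqxx.
case: pickP => // v /andP[vI /asboolP [s [ps ls ss As]]] [<-] {i}.
exists s; split=> //; apply/allP => y ys; apply/eqP/ball_mapP => //.
case/splitPl: ys ps ls ss As => s1 s2 ly; rewrite cat_path size_cat -cat_cons all_cat.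
move=> /andP[ps1 _] _ ss /andP[As1 _]; exists s1; split=> //.
by apply: leq_trans ss; rewrite leq_addr.
Qed.

Lemma ball_map_centers : centers ball_map = dom f.
Proof.
apply/setP => x; rewrite !inE /ball_map; have [fx|fx] := eqVneq (f x) None; last by rewrite eqxx.
case: pickP => // v /andP[vI _]; apply/negP => /eqP [vx].
by rewrite -vx (fI vI) in fx.
Qed.

(** Since [S] lies in the domain of [f], a walk from [v] to [S :\ v] must leave the free vertices;
    the first domain vertex other than [v] on it is a singleton cluster adjacent to the ball of
    [v]. *)
Lemma ball_map_hits (S : {set H}) v : S \subset dom f -> v \in I ->
  hits m (cdeg ball_map v) v S.
Proof.
move=> Sd vI; exists [set j | cadj ball_map v j] => // s ps ss ls.
have ne x : x \in dom f -> f x != None by rewrite inE.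
have lsd : ~~ Pb v (last v s).
  by move: ls; rewrite /Pb !inE negb_or => /andP[-> /(subsetP Sd)/ne ->].
have hs : has (predC (Pb v)) s.
  apply/hasP; exists (last v s) => //; move: ls; case: (s) => [|a t _] /=; last exact: (mem_last a t).
  by rewrite !inE eqxx.
case: (split_find hs) ps ss ls lsd => y s1 s2 nPy; rewrite -all_predC => As1 ps ss _ _.
rewrite cat_rcons in ps ss *.
have As1' : all (Pb v) (v :: s1).
  rewrite /= {1}/Pb eqxx orbT /=; apply: sub_all As1 => z /=; exact: negPn.
have [wl ly] := walk_prefix ps ss As1'.
rewrite has_cat /=; apply/orP; right; apply/orP; left; rewrite inE.
move: nPy; rewrite /= /Pb negb_or => /andP[fy yv].
apply/cadjP; split; first by move/eqP; rewrite eq_sym (negbTE yv).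
exists (last v s1), y; split=> //; first exact: ball_mapP.
by rewrite /ball_map (negbTE fy).
Qed.

End Ball.

Lemma hits_le (H : sgraph) m N N' v (S : {set H}) : N <= N' -> hits m N v S -> hits m N' v S.
Proof. by move=> NN [F FN hF]; exists F => //; exact: leq_trans NN. Qed.

(* In a maximal admissible map f, the clusters of the bad vertices of low degree
   contain a large independent family I. The balls around I outside the domain of
   f are disjoint, and each of them has more than N neighbours in the domain since
   these neighbours hit all walks from its center to S: too many edges for a
   shallow minor on few vertices. *)
Lemma few_bad (d : nat -> nat) m : exists N, forall (H : sgraph) (S : {set H}),
  sparse d H -> S != set0 -> 2 * #|[set v in S | ~~ `[< hits m N v S >]]| < #|S|.
Proof.
(* The clusters of [f] have average degree at most [d1], so at most a quarter of [S] has degree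
   above [k = 4 * d1], and a quarter of [S] is both bad and of low degree. Hence
   [#|S| <= 4 * k.+1 * #|I|] and [#|dom f| <= (1 + (m + m) * d1) * #|S|]; with the factor [d m] the
   product of these constants is [N]. *)
pose d1 := d (m + m); pose k := 4 * d1; pose N := d m * (1 + (m + m) * d1) * (4 * k.+1).
exists N => H S sp S0; rewrite ltnNge; apply/negP; set B := [set v in S | _] => lB.
have [f [cf ce df] fmax] := admissible_maximal m S.
have fS x : x \in S -> f x = Some x by rewrite -ce inE => /eqP.
have nf : nadj f <= d1 * #|S| by rewrite (nadjE cf) -ce; exact: sp.
pose B' := [set v in B | cdeg f v <= k].
have BS : B \subset S by apply/subsetP => v; rewrite inE => /andP[].
have hB : #|B :\: B'| * k.+1 <= d1 * #|S|.
  apply: leq_trans nf; rewrite (nadjE cf) ce -sum_nat_const.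
  rewrite [leqRHS](bigID (mem (B :\: B'))) /=.
  apply: leq_trans (leq_addr _ _).
  rewrite [leqRHS](eq_bigl (fun v => v \in B :\: B')).
    apply: leq_sum => v; rewrite !inE; case/andP => + /andP[vS vb]; rewrite vS vb /=.
    by rewrite -ltnNge.
  move=> v; rewrite andb_idl // => /setDP[vB _]; exact: (subsetP BS).
have B'B : B' \subset B by apply/subsetP => v; rewrite inE => /andP[].
have cB := cardsID B' B; rewrite (setIidPr B'B) in cB.
have hB' : #|S| <= 4 * #|B'|.
  have : 4 * #|B :\: B'| <= #|S|.
    have [d0|d0] := posnP d1; first by move: hB; rewrite d0 mul0n leqn0 muln_eq0 orbF => /eqP ->.
    rewrite -(leq_pmul2l d0); apply: leq_trans hB; rewrite /k; nia.
  lia.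
have [||I [IB' Iind cI]] := @independent_subset H (cadj f) B' k; first exact: cadj_sym.
  by move=> v; rewrite inE => /andP[].
have IS : I \subset S by apply: subset_trans IB' (subset_trans B'B BS).
have Sd : S \subset dom f by apply/subsetP => x /fS fx; rewrite inE fx.
have fI : {in I, forall v, f v = Some v} by move=> v vI; apply/fS/(subsetP IS).
have disj v w x : v \in I -> w \in I -> f x = None ->
    walk (fun x => (f x == None) || (x == v)) m v x ->
    walk (fun x => (f x == None) || (x == w)) m w x -> v = w.
  move=> vI wI fx wv ww; have [//|vw] := eqVneq v w.
  have [] // := Iind v w vI wI; rewrite (fmax v w (m + m)) //; last 2 first.
  - exact: (subsetP IS).
  - exact: (subsetP IS).
  apply: (walk_cat (y := x)).
    by apply: walk_sub wv => // z /orP[->|->]; rewrite ?orbT.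
  by apply: walk_sub (walk_sym ww) => // z /orP[->|->]; rewrite ?orbT.
have cg := ball_map_cluster disj.
have := sp _ _ cg; rewrite (ball_map_centers m fI) => low.
have Id : I \subset dom f := subset_trans IS Sd.
have up : #|I| * N.+1 <= d m * #|dom f|.
  apply: leq_trans low; rewrite -sum_nat_const [leqRHS](bigID (mem I)) /=.
  apply: leq_trans (leq_addr _ _); rewrite [leqRHS](eq_bigl (fun v => v \in I)); last first.
    by move=> v; rewrite andb_idl // => /(subsetP Id).
  apply: leq_sum => v vI; rewrite ltnNge; apply/negP => le.
  have := subsetP B'B v (subsetP IB' v vI); rewrite inE => /andP[_ /negP]; apply.
  by apply/asboolP; apply: hits_le le _; exact: (ball_map_hits disj).
have I0 : 0 < #|I|.
  by rewrite lt0n; apply/eqP => I0; move: hB' S0; rewrite -card_gt0; move: cI; rewrite I0; lia.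
have e1 : #|dom f| <= (1 + (m + m) * d1) * #|S| by nia.
have e2 : #|S| <= 4 * k.+1 * #|I| by nia.
have : #|I| * N.+1 <= #|I| * N.
  apply: leq_trans up _; rewrite /N -mulnA [leqRHS]mulnC -!mulnA leq_mul2l; apply/orP; right.
  by apply: leq_trans e1 _; rewrite leq_mul2l mulnA e2 orbT.
by rewrite leq_pmul2l // ltnn.
Qed.

Section WeakReach.
Variables (H : sgraph) (rk : H -> nat).

Definition wreach n v : {set H} := [set w | `[< walk (fun x => rk w <= rk x) n v w >]].

Lemma wreachP n v w : reflect (walk (fun x => rk w <= rk x) n v w) (w \in wreach n v).
Proof. by rewrite inE; exact: asboolP. Qed.

Lemma wreach_self n v : v \in wreach n v.
Proof. apply/wreachP; exact: walk0. Qed.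

Lemma wreach_le n v w : w \in wreach n v -> rk w <= rk v.
Proof. by move/wreachP/walk_start. Qed.

(* A walk witnessing weak reachability from v visits some x in the hitting set of
   v, and its remainder is a shorter witness from x. *)
Lemma card_wreach m N n v : (forall v, hits m N v [set w | rk w <= rk v]) -> n <= m ->
  #|wreach n v| <= N.+1 ^ n.
Proof.
move=> hN; elim: n v => [|n IH] v nm.
  rewrite expn0 -(cards1 v); apply: subset_leq_card; apply/subsetP => w /wreachP [[|? ?]] [] //= _ <-.
  by rewrite inE.
have [F FN hF] := hN v.
have sub : wreach n.+1 v \subset v |: \bigcup_(x in F) wreach n x.
  apply/subsetP => w ww; rewrite !inE; have [//|wv] := eqVneq w v; rewrite /=.
  have le := wreach_le ww; case/wreachP: ww => s [ps ls ss As].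
  have /hasP [x xs xF] : has (mem F) s.
    by apply: hF => //; [exact: leq_trans nm|rewrite ls !inE wv].
  apply/bigcupP; exists x => //; apply/wreachP.
  case/splitPr: xs ps ls ss As => s1 s2; rewrite cat_path last_cat size_cat /= all_cat.
  move=> /and3P[_ _ ps2] ls ss /and3P[_ _ As2]; exists s2; split=> //; lia.
apply: leq_trans (subset_leq_card sub) _; apply: leq_trans (leq_card_setU _ _) _.
have sb : #|\bigcup_(x in F) wreach n x| <= \sum_(x in F) N.+1 ^ n.
  apply: (@leq_trans (\sum_(x in F) #|wreach n x|)).
    elim/big_rec2: _ => [|x k A _ IH']; first by rewrite cards0.
    by apply: leq_trans (leq_card_setU _ _) _; rewrite leq_add2l.
  by apply: leq_sum => x _; apply: IH; exact: ltnW.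
move: sb; rewrite sum_nat_const cards1 expnS => sb.
have : 0 < N.+1 ^ n by rewrite expn_gt0.
nia.
Qed.

End WeakReach.

(** A vertex [v] of [S] good at both radii gets the largest rank, so that [S] becomes the set of
    vertices up to [v]; then [S :\ v] is ordered in the same way. *)
Lemma good_order (H : sgraph) m1 N1 m2 N2 :
  (forall S : {set H}, S != set0 -> exists2 v, v \in S & hits m1 N1 v S /\ hits m2 N2 v S) ->
  exists2 rk : H -> nat, injective rk &
    forall v, hits m1 N1 v [set w | rk w <= rk v] /\ hits m2 N2 v [set w | rk w <= rk v].
Proof.
move=> hS; suff [rk [rinj _ rP]] : exists rk : H -> nat, [/\ {in setT &, injective rk},
    {in setT, forall v, rk v < #|[set: H]|} &
    {in setT, forall v, let D := [set w in setT | rk w <= rk v] in hits m1 N1 v D /\ hits m2 N2 v D}].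
  exists rk => [x y|v]; first by apply: rinj.
  have /= := rP v (in_setT v).
  by rewrite (_ : [set w in _ | _] = [set w | rk w <= rk v]) //; apply/setP => w; rewrite !inE.
move: {2}(#|_|) (erefl #|[set: H]|) => n; elim: n setT => [|n IH] S.
  move/eqP; rewrite cards_eq0 => /eqP ->; exists (fun=> 0).
  by split=> [x|x|x]; rewrite inE.
move=> cS; have [|v vS hv] := hS S; first by rewrite -card_gt0 cS.
have cSv : #|S :\ v| = n by have := cardsD1 v S; rewrite vS cS => -[].
have [rk [rinj rlt rP]] := IH _ cSv.
exists (fun x => if x == v then n else rk x).
have inSv x : x \in S -> x != v -> x \in S :\ v by rewrite !inE => -> ->.
split=> [x y xS yS|x xS|x xS] /=.
- have [->|xv] := eqVneq x v; have [->|yv] := eqVneq y v => //.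
  + by have := rlt y (inSv _ yS yv); rewrite cSv => lt e; rewrite e ltnn in lt.
  + by have := rlt x (inSv _ xS xv); rewrite cSv => lt e; rewrite e ltnn in lt.
  + by apply: rinj; exact: inSv.
- case: eqP => [_|/eqP xv]; first by rewrite cS.
  by have := rlt x (inSv _ xS xv); rewrite cSv cS; exact: leqW.
have [->|xv] := eqVneq x v.
  rewrite (_ : [set w in _ | _] = S) //; apply/setP => w; rewrite !inE andb_idr // => wS.
  by case: eqP => // /eqP wv; have := rlt w (inSv _ wS wv); rewrite cSv => /ltnW.
rewrite (_ : [set w in _ | _] = [set w in S :\ v | rk w <= rk x]); first exact: rP (inSv _ xS xv).
apply/setP => w; rewrite !inE; case: eqP => [->|_] //.
by rewrite leqNgt (_ : rk x < n) ?andbF // -cSv; exact: rlt (inSv _ xS xv).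
Qed.

Lemma wreach_order (d : nat -> nat) : exists b : nat -> nat,
  forall m1 m2 (H : sgraph), sparse d H ->
  exists2 rk : H -> nat, injective rk &
    forall v, #|wreach rk m1 v| <= b m1 /\ #|wreach rk m2 v| <= b m2.
Proof.
have [N NP] := choice (few_bad d); exists (fun m => (N m).+1 ^ m) => m1 m2 H sp.
have [|rk rinj rP] := @good_order H m1 (N m1) m2 (N m2).
  move=> S S0; have c1 := NP m1 H S sp S0; have c2 := NP m2 H S sp S0.
  set B1 := [set v in S | _] in c1; set B2 := [set v in S | _] in c2.
  have : ~~ (S \subset B1 :|: B2).
    apply/negP => /subset_leq_card.
    by move: (leq_card_setU B1 B2).1 c1 c2; lia.
  case/subsetPn => v vS; rewrite !inE vS /= negb_or !negbK => /andP[/asboolP h1 /asboolP h2].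
  by exists v.
exists rk => // v; split.
  by apply: (@card_wreach _ _ m1) => // w; have [] := rP w.
by apply: (@card_wreach _ _ m2) => // w; have [] := rP w.
Qed.

(** Colours are given by increasing rank: the at most [K] colours seen in [B v] leave one of the
    [K.+1] free. *)
Lemma greedy_coloring (T : finType) (rk : T -> nat) (B : T -> {set T}) K :
  injective rk -> (forall v w, w \in B v -> rk w <= rk v) -> (forall v, #|B v| <= K) ->
  exists c : T -> 'I_K.+1, forall v w, w \in B v -> w != v -> c w != c v.
Proof.
move=> rinj Bd BK.
suff [c cP] : exists c : T -> 'I_K.+1, forall v w, rk v < (\max_v rk v).+1 -> w \in B v -> w != v -> c w != c v.
  by exists c => v w; apply: cP; rewrite ltnS; exact: leq_bigmax.
elim: (\max_v rk v).+1 => [|n [c cP]]; first by exists (fun=> ord0).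
have [[v /eqP vn]|nv] := pselect (exists v, rk v == n); last first.
  exists c => v w; rewrite ltnS leq_eqVlt => /orP[vn|]; last exact: cP.
  by case: nv; exists v.
have [a aP] : exists a, a \notin c @: B v.
  have : ~~ (setT \subset c @: B v).
    apply/negP => /subset_leq_card; rewrite cardsT card_ord leqNgt ltnS.
    by rewrite (leq_trans (leq_imset_card _ _)).
  by case/subsetPn => a _; exists a.
exists (fun x => if x == v then a else c x) => x w lt wx wnx.
have [xv|xv] := eqVneq x v.
  rewrite xv in wx wnx; rewrite (negbTE wnx); apply: contraNneq aP => <-; exact: imset_f.
have [wv|_] := eqVneq w v.
  have := Bd _ _ wx; rewrite wv vn => le; move: lt; rewrite ltnS leq_eqVlt ltnNge le orbF => /eqP.
  by rewrite -vn => /rinj; move/eqP: xv.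
apply: cP => //; move: lt; rewrite ltnS leq_eqVlt => /orP[/eqP|//].
by rewrite -vn => /rinj; move/eqP: xv.
Qed.

(** * Locality of first-order formulas *)

Section Scattered.
Variables (H : sgraph) (S : {set H}).

(** The walk avoids [S] at its ends too: a vertex of [S] is near nothing, not even itself. *)
Definition near r (x y : H) : Prop := walk (fun z => z \notin S) r x y.

Definition scattered r n (b : n.-tuple nat) (e : n.-tuple H) : Prop :=
  forall i j, tnth b i <> tnth b j -> ~ near r (tnth e i) (tnth e j).

(** Entries of other blocks are erased rather than removed, which keeps the positions of the
    variables. *)
Definition mask (beta : nat) n (b : n.-tuple nat) (e : n.-tuple H) : seq (option H) :=
  [seq if p.1 == beta then Some p.2 else None | p <- zip b e].

Lemma near_le r r' x y : r <= r' -> near r x y -> near r' x y.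
Proof. by move=> rr; apply: walk_sub. Qed.

Lemma near_sym r x y : near r x y -> near r y x.
Proof. exact: walk_sym. Qed.

Lemma near_cat r r' x y z : near r x y -> near r' y z -> near (r + r') x z.
Proof. exact: walk_cat. Qed.

Lemma scattered_le r r' n (b : n.-tuple nat) e : r <= r' -> scattered r' b e -> scattered r b e.
Proof. by move=> rr se i j /se h /(near_le rr). Qed.

Lemma size_mask beta n (b : n.-tuple nat) (e : n.-tuple H) : size (mask beta b e) = n.
Proof. by rewrite size_map size_zip !size_tuple minnn. Qed.

Lemma nth_mask beta n (b : n.-tuple nat) (e : n.-tuple H) (i : 'I_n) :
  nth None (mask beta b e) i = if tnth b i == beta then Some (tnth e i) else None.
Proof.
rewrite (nth_map (0, tnth e i)) ?size_zip ?size_tuple ?minnn //.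
by rewrite nth_zip ?size_tuple //= -!tnth_nth.
Qed.

Lemma mem_mask beta n (b : n.-tuple nat) (e : n.-tuple H) y :
  reflect (exists2 i, tnth b i = beta & tnth e i = y) (Some y \in mask beta b e).
Proof.
apply: (iffP (nthP None)) => [[k]|[i bi ei]]; last first.
  by exists i; rewrite ?size_mask // nth_mask bi ei eqxx.
rewrite size_mask => kn; rewrite (nth_mask beta b e (Ordinal kn)).
by case: eqP => // bk [ek]; exists (Ordinal kn).
Qed.

Lemma mask_cons beta n beta0 x (b : n.-tuple nat) (e : n.-tuple H) :
  mask beta [tuple of beta0 :: b] [tuple of x :: e] =
  (if beta0 == beta then Some x else None) :: mask beta b e.
Proof. by []. Qed.

Lemma mask_fresh beta n (b : n.-tuple nat) (e : n.-tuple H) :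
  (forall i, tnth b i <> beta) -> mask beta b e = nseq n None.
Proof.
move=> fb; apply: (@eq_from_nth _ None); rewrite size_mask ?size_nseq // => i ilt.
rewrite (nth_mask beta b e (Ordinal ilt)) nth_nseq ilt.
by case: eqP => // /fb.
Qed.

Lemma scattered_cons r n (b : n.-tuple nat) (e : n.-tuple H) beta x :
  scattered r b e -> (forall i, tnth b i <> beta -> ~ near r x (tnth e i)) ->
  scattered r [tuple of beta :: b] [tuple of x :: e].
Proof.
move=> se sx i j; case: (unliftP ord0 i) => [i'|] ->; case: (unliftP ord0 j) => [j'|] ->;
  rewrite ?tnthS ?tnth0 // => ne.
- exact: se.
- by move/near_sym; exact: sx.
- by apply: sx => /esym.
Qed.

(** What is within [r] of [x] is within [r + 3 * r] of entry [i]; this is the factor 4 lost at each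
    quantifier. *)
Lemma scattered_cons_near r n (b : n.-tuple nat) (e : n.-tuple H) x i :
  scattered (4 * r) b e -> near (3 * r) x (tnth e i) ->
  scattered r [tuple of tnth b i :: b] [tuple of x :: e].
Proof.
move=> se xi; apply: scattered_cons => [|j ij xj]; first by apply: scattered_le se; lia.
apply: (se j i) => //; apply: near_le (near_cat (near_sym xj) xi); lia.
Qed.

(** Names the members of [S] within a set depending only on [s]. When [#|S| <= s], all vertices
    outside [S] share the index [#|S|], which no member has. *)
Definition rank_in s (x : option H) : 'I_s.+1 := 
  if x is Some y then inord (index y (enum S)) else ord0.

Lemma rank_in_eq s x y : #|S| <= s -> rank_in s (Some x) = rank_in s (Some y) ->
  x \in S -> x = y.
Proof.
move=> Ss /(congr1 val) /=.
have lt z : index z (enum S) < s.+1.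
  by rewrite ltnS; apply: leq_trans (index_size _ _) _; rewrite -cardE.
rewrite !inordK // => xy xS; rewrite -mem_enum in xS.
by rewrite -(nth_index x xS) xy nth_index // -index_mem -xy index_mem.
Qed.

End Scattered.

Section Types.
Variable k : nat.

(* theta is evaluated on each block of the partition of the variables induced by
   b; only tuples whose distinct blocks are far apart in H - S are compared. The
   finite set T may depend on s, but r may not. *)
Definition local_types n r (hold : forall H, coloring k H -> n.-tuple H -> bool) : Prop :=
  forall s, exists T : finType, forall (H : sgraph) (M : coloring k H) (S : {set H}), #|S| <= s ->
  exists theta : seq (option H) -> T, forall (b : n.-tuple nat) (e e' : n.-tuple H),
    scattered S r b e -> scattered S r b e' ->
    (forall beta, theta (mask beta b e) = theta (mask beta b e')) -> hold H M e = hold H M e'.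

Lemma local_types_le n r r' hold : r <= r' -> @local_types n r hold -> local_types r' hold.
Proof.
move=> rr lt s; have [T TP] := lt s; exists T => H M S Ss; have [th thP] := TP H M S Ss.
by exists th => b e e' se se'; apply: thP; exact: scattered_le rr _.
Qed.

(** Inside one block the relation is read off the mask. Across blocks, if one entry lies in [S], the
    relation is recorded among the [S]-neighbours of the other; if neither does, the relation would
    make them near. *)
Lemma local_types_rel n (i j : 'I_n) (rl : forall H : sgraph, rel H) :
  (forall H, symmetric (rl H)) ->
  (forall (H : sgraph) (S : {set H}) (x y : H), rl H x y -> x \notin S -> y \notin S -> near S 1 x y) ->
  local_types 1 (fun H M e => rl H (tnth e i) (tnth e j)).
Proof.
move=> rsym rnear s.
exists (bool * (('I_s.+1 * {set 'I_s.+1}) * ('I_s.+1 * {set 'I_s.+1})))%type => H M S Ss.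
pose nb (x : option H) : {set 'I_s.+1} := [set rank_in S s (Some z) | z in
  [set z in S | if x is Some y then rl H z y else false]].
pose loc x := (rank_in S s x, nb x).
exists (fun m => (if (nth None m i, nth None m j) is (Some x, Some y) then rl H x y else false,
  (loc (nth None m i), loc (nth None m j)))) => b e e' se se' th.
have := th (tnth b i); rewrite !nth_mask eqxx; case: eqP => [_ /(congr1 fst) //|/nesym bij /(congr1 (fun p => p.2.1)) [ri ni]].
have := th (tnth b j); rewrite !nth_mask eqxx; case: eqP => // _ /(congr1 (fun p => p.2.2)) [rj nj].
have inS x x' : rank_in S s (Some x) = rank_in S s (Some x') -> (x \in S) = (x' \in S).
  by move=> xx'; apply/idP/idP => h; [rewrite -(rank_in_eq Ss xx' h)|rewrite -(rank_in_eq Ss (esym xx') h)].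
have via x y y' : x \in S -> nb (Some y) = nb (Some y') -> rl H x y -> rl H x y'.
  move=> xS nyy xy; have : rank_in S s (Some x) \in nb (Some y).
    by apply: imset_f; rewrite inE xS.
  by rewrite nyy => /imsetP[z]; rewrite inE => /andP[zS zy] /(rank_in_eq Ss) -/(_ xS) ->.
case: (boolP (tnth e i \in S)) => iS.
  rewrite -(rank_in_eq Ss ri iS); apply/idP/idP; exact: via.
case: (boolP (tnth e j \in S)) => jS.
  rewrite -(rank_in_eq Ss rj jS) ![rl H _ (tnth e j)]rsym; apply/idP/idP; exact: via.
apply/idP/idP => h; [case: (se i j bij)|case: (se' i j bij)]; apply: rnear => //.
  by rewrite -(inS _ _ ri).
by rewrite -(inS _ _ rj).
Qed.

Lemma maximal_scattered (H : sgraph) (S A : {set H}) r : exists W : {set H},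
  [/\ W \subset A, {in W &, forall w w', near S r w w' -> w = w'} &
    forall x, x \in A -> exists2 w, w \in W & w = x \/ near S r w x].
Proof.
pose P (W : {set H}) := `[< W \subset A /\ {in W &, forall w w', near S r w w' -> w = w'} >].
have P0 : P set0 by apply/asboolP; split; [exact: sub0set|move=> w w'; rewrite inE].
have [W /maxsetP[/asboolP[WA Wi] Wmax] _] := maxset_exists P0.
exists W; split=> // x xA.
case: (pselect (exists2 w, w \in W & near S r w x)) => [[w wW wx]|nx].
  by exists w => //; right.
exists x; last by left.
suff E : x |: W = W by rewrite -E setU11.
apply: Wmax; last exact: subsetUr.
apply/asboolP; split; first by rewrite subUset sub1set xA.
move=> w w'; rewrite !inE => /orP[/eqP ->|wW] /orP[/eqP ->|wW'] //.
- by move=> /near_sym h; case: nx; exists w'.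
- by move=> h; case: nx; exists w.
- exact: Wi.
Qed.

(* A witness x within distance 3 r of a tuple joins a block. Any other witness
   may be replaced by a member w of a maximal 2 r-scattered set W t of vertices of
   the type t of x, and w is not covered by the r-balls around the tuple. If W t
   has more than n members one of them is always uncovered, since a ball covers at
   most one; otherwise theta records which members each block covers. *)
Lemma local_types_exists n r (hold : forall H, coloring k H -> n.+1.-tuple H -> bool) :
  local_types r hold ->
  local_types (4 * r) (fun H M (e : n.-tuple H) => [exists x : H, hold H M [tuple of x :: e]]).
Proof.
move=> lt s; have [T TP] := lt s; exists (T * ({set T} * {ffun T -> {set 'I_n.+1}}))%type => H M S Ss.
have [th thP] := TP H M S Ss.
pose tp x := th (Some x :: nseq n None).
have [W WP] := choice (fun t => maximal_scattered S [set x | tp x == t] (2 * r)).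
(* These indices are read only when [W t] has at most [n] members, and are then faithful. *)
pose idx t x : 'I_n.+1 := inord (index x (enum (W t))).
pose ext (m : seq (option H)) := [set th (Some x :: m) | x in [set x | `[< exists2 y, Some y \in m & near S (3 * r) x y >]]].
pose cov (m : seq (option H)) := [ffun t => [set idx t w | w in
  [set w in W t | `[< exists2 y, Some y \in m & near S r w y >]]]].
exists (fun m => (th (None :: m), (ext m, cov m))) => b.
suff half (e e' : n.-tuple H) : scattered S (4 * r) b e -> scattered S (4 * r) b e' ->
    (forall beta, (th (None :: mask beta b e), (ext (mask beta b e), cov (mask beta b e))) =
                  (th (None :: mask beta b e'), (ext (mask beta b e'), cov (mask beta b e')))) ->
    [exists x, hold H M [tuple of x :: e]] -> [exists x, hold H M [tuple of x :: e']].
  by move=> e e' se se' E; apply/idP/idP; apply: half => // beta; rewrite E.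
move=> se se' E /existsP[x fx].
have Eth beta : th (None :: mask beta b e) = th (None :: mask beta b e') by case: (E beta).
have Eext beta : ext (mask beta b e) = ext (mask beta b e') by case: (E beta).
have Ecov beta : cov (mask beta b e) = cov (mask beta b e') by case: (E beta).
case: (pselect (exists i, near S (3 * r) x (tnth e i))) => [[i xi]|far].
  have : th (Some x :: mask (tnth b i) b e) \in ext (mask (tnth b i) b e).
    apply: imset_f; rewrite inE; apply/asboolP; exists (tnth e i) => //.
    by apply/mem_mask; exists i.
  rewrite Eext => /imsetP[x']; rewrite inE => /asboolP[y /mem_mask[i' bi <-] x'i'] tx.
  apply/existsP; exists x'.
  suff <- : hold H M [tuple of x :: e] = hold H M [tuple of x' :: e'] by [].
  apply: (thP [tuple of tnth b i :: b]).
  - exact: scattered_cons_near.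
  - by rewrite -bi; exact: scattered_cons_near.
  - by move=> beta; rewrite !mask_cons; case: eqP => [<-|_]; [exact: tx|exact: Eth].
pose t := tp x; have [Wt Wi Wc] := WP t.
have [|w wW wx] := Wc x; first by rewrite inE.
have wfar i : ~ near S r w (tnth e i).
  move=> wi; apply: far; exists i; case: wx => [<-|wx]; first by apply: near_le wi; lia.
  by apply: near_le (near_cat (near_sym wx) wi); lia.
have [w' w'W w'far] : exists2 w', w' \in W t & forall i, ~ near S r w' (tnth e' i).
  have [Wn|Wn] := leqP #|W t| n.
    exists w => // i wi.
    have : idx t w \in cov (mask (tnth b i) b e') t.
      rewrite ffunE; apply: imset_f; rewrite inE wW; apply/asboolP; exists (tnth e' i) => //.
      by apply/mem_mask; exists i.
    rewrite -Ecov ffunE => /imsetP[v]; rewrite inE => /andP[vW /asboolP[y /mem_mask[j _ <-] vj]].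
    move/(congr1 val) => /=.
    have ltn' z : index z (enum (W t)) < n.+1.
      by rewrite ltnS; apply: leq_trans (index_size _ _) _; rewrite -cardE.
    rewrite !inordK // => ei; case: (wfar j); suff -> : w = v by [].
    by rewrite -(nth_index w (s := enum (W t)) (x := w)) ?mem_enum // ei nth_index ?mem_enum.
  apply: contrapT => none.
  have some_near w' : w' \in W t -> exists i, near S r w' (tnth e' i).
    move=> w'W; apply: contrapT => ni; apply: none; exists w' => // i wi; apply: ni.
    by exists i.
  have all_near w' : exists i, w' \in W t -> near S r w' (tnth e' i).
    have [i0 _] := some_near w wW.
    by have [/some_near[i wi]|_] := boolP (w' \in W t); [exists i|exists i0].
  have [g gP] := choice all_near.
  have ginj : {in W t &, injective g}.
    move=> u v uW vW guv; apply: Wi => //; have := gP v vW; rewrite -guv => /near_sym vg.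
    by apply: near_le (near_cat (gP u uW) vg); lia.
  by have := card_in_imset ginj; have := max_card (g @: W t); rewrite card_ord => le eq; rewrite eq leqNgt Wn in le.
have tw' : tp w' = t by have := subsetP Wt w' w'W; rewrite inE => /eqP.
pose beta0 := (\max_(i < n) tnth b i).+1.
have fresh i : tnth b i <> beta0.
  by move=> bi; have := @leq_bigmax _ (tnth b) i; rewrite bi ltnn.
apply/existsP; exists w'.
suff <- : hold H M [tuple of x :: e] = hold H M [tuple of w' :: e'] by [].
apply: (thP [tuple of beta0 :: b]).
- apply: scattered_cons => [|i _ xi]; first by apply: scattered_le se; lia.
  by apply: far; exists i; apply: near_le xi; lia.
- apply: scattered_cons => [|i _]; last exact: w'far.
  by apply: scattered_le se'; lia.
- move=> beta; rewrite !mask_cons; case: eqP => [<-|_]; last exact: Eth.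
  by rewrite !mask_fresh.
Qed.

Lemma formula_local_types n (f : formula k n) :
  exists r, local_types r (fun H M => @holds k H M n f).
Proof.
elim: n / f => [n i j|n i j|n c i|n f [r IH]|n f [r IHf] g [r' IHg]|n f [r IH]].
- exists 1; apply: (local_types_rel i j (rl := fun H : sgraph => @eq_op H)) => [H x y|H S x y /eqP <- xS _].
    exact: eq_sym.
  exact: walk0.
- exists 1; apply: (local_types_rel i j (rl := fun H => @sedge H)) => [H|H S x y xy xS yS].
    exact: sedge_sym.
  by exists [:: y]; rewrite /= xy xS yS.
- exists 0 => s; exists bool => H M S _.
  exists (fun m => if nth None m i is Some x then x \in M c else false) => b e e' _ _ th /=.
  by have := th (tnth b i); rewrite !nth_mask eqxx.
- exists r => s; have [T TP] := IH s; exists T => H M S Ss; have [th thP] := TP H M S Ss.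
  by exists th => b e e' se se' E /=; congr (~~ _); exact: thP E.
- exists (maxn r r') => s.
  have [T TP] := local_types_le (leq_maxl r r') IHf s.
  have [T' TP'] := local_types_le (leq_maxr r r') IHg s.
  exists (T * T')%type => H M S Ss; have [th thP] := TP H M S Ss; have [th' thP'] := TP' H M S Ss.
  exists (fun m => (th m, th' m)) => b e e' se se' E /=; congr (_ && _).
    by apply: thP se se' _ => beta; case: (E beta).
  by apply: thP' se se' _ => beta; case: (E beta).
- exists (4 * r); exact: (local_types_exists IH).
Qed.

End Types.

(** * Edges of a transduction *)

Section NormalForm.

(* The types depend on the deleted set S, so the table that evaluates f from them
   depends on S too. *)
Lemma formula2_types k (f : formula k 2) : exists r, forall N, exists T : finType,
  forall (H : sgraph) (M : coloring k H),
  exists (tl tr : {set H} -> H -> T) (tab : {set H} -> T -> T -> bool),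
  forall (S : {set H}) u v, #|S| <= N -> ~ near S r u v ->
    holds M f [tuple u; v] = tab S (tl S u) (tr S v).
Proof.
have [r lt] := formula_local_types f; exists r => N; have [T TP] := lt N; exists T => H M.
have all_theta (S : {set H}) : exists th : seq (option H) -> T, #|S| <= N ->
    forall (b : 2.-tuple nat) (e e' : 2.-tuple H), scattered S r b e -> scattered S r b e' ->
    (forall beta, th (mask beta b e) = th (mask beta b e')) -> holds M f e = holds M f e'.
  have [SN|SN] := leqP #|S| N; first by have [th thP] := TP H M S SN; exists th.
  (* For larger [S] any function will do; the one for the empty set is at hand even though [T] has
     no distinguished element. *)
  by have [th _] := TP H M set0 (leq_trans (eq_leq (cards0 H)) (leq0n N)); exists th.
have [th thP] := choice all_theta.
exists (fun S u => th S [:: Some u; None]), (fun S v => th S [:: None; Some v]).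
(* The table is read off the far pairs realizing the two types; [thP] says that all such pairs
   agree. *)
exists (fun S t t' => `[< exists u v, [/\ ~ near S r u v, th S [:: Some u; None] = t,
  th S [:: None; Some v] = t' & holds M f [tuple u; v]] >]).
move=> S u v SN nuv; apply/idP/asboolP => [h|[u' [v' [nuv' eu ev]]]]; first by exists u, v.
suff sc x y : ~ near S r x y -> scattered S r [tuple 0; 1] [tuple x; y].
  suff -> : holds M f [tuple u; v] = holds M f [tuple u'; v'] by [].
  apply: (thP S SN [tuple 0; 1]); [exact: sc|exact: sc|].
  by move=> [|[|beta]].
move=> nxy i j; case: (unliftP ord0 i) => [i'|] ->; case: (unliftP ord0 j) => [j'|] ->;
  rewrite ?ord1 ?tnthS ?tnth0 //= => _ h; apply: nxy => //; exact: near_sym.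
Qed.

Variables (H : sgraph) (rk : H -> nat).

(** The vertex of least rank cuts the walk into two witnesses of weak reachability. *)
Lemma walk_min (P : pred H) n u v : walk P n u v ->
  exists w, [/\ P w, w \in wreach rk n u & w \in wreach rk n v].
Proof.
move=> [s [ps ls ss As]].
have us : u \in u :: s by rewrite mem_head.
case: (arg_minnP rk us) => w ws wm; have {wm} wmin z : z \in u :: s -> rk w <= rk z by exact: wm.
exists w; split; first exact: (allP As).
  apply/wreachP; case/splitPl: ws ps ss wmin => s1 s2 l1; rewrite cat_path => /andP[p1 _] ss wmin.
  exists s1; split=> //; first by apply: leq_trans ss; rewrite size_cat leq_addr.
  by apply/allP => y ys; apply: wmin; rewrite -cat_cons mem_cat ys.
apply/wreachP/walk_sym; case/splitPl: ws ps ss wmin ls => s1 s2 l1.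
rewrite cat_path => /andP[_ p2] ss wmin; rewrite last_cat => l2; rewrite l1 in p2 l2.
exists s2; split=> //; first by apply: leq_trans ss; rewrite size_cat leq_addl.
apply/allP => y ys; apply: wmin; move: ys; rewrite inE => /orP[/eqP ->|ys].
  by rewrite -cat_cons mem_cat -l1 mem_last.
by rewrite -cat_cons mem_cat ys orbT.
Qed.

End NormalForm.

(** By [walk_min], deleting the common part of the two reachability sets leaves [u] and [v] far
    apart, so their types decide [f]. A label from a fixed finite set cannot name that part, so it
    lists types and a table for every set of colours. *)
Lemma formula_normal_form k (f : formula k 2) : exists r, forall N K, exists L : finType,
  forall (H : sgraph) (M : coloring k H) (rk : H -> nat) (a : H -> 'I_K),
  (forall v, #|wreach rk r v| <= N) -> (forall v, {in wreach rk r v &, injective a}) ->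
  exists (lam : H -> L) (Q : L -> L -> {set 'I_K} -> bool), forall u v,
    holds M f [tuple u; v] = Q (lam u) (lam v) (a @: (wreach rk r u :&: wreach rk r v)).
Proof.
have [r rP] := formula2_types f; exists r => N K; have [T TP] := rP N.
pose L : finType := {ffun {set 'I_K} -> T * T * {ffun T * T -> bool}}; exists L => H M rk a RN ainj.
have [tl [tr [tab tP]]] := TP H M.
(* S is recovered from u, and likewise from v, by its set of colours. *)
pose sep u (A : {set 'I_K}) := [set x in wreach rk r u | a x \in A].
exists (fun u => [ffun A => (tl (sep u A) u, tr (sep u A) u, [ffun p => tab (sep u A) p.1 p.2])]).
exists (fun (l l' : L) A => (l A).2 ((l A).1.1, (l' A).1.2)) => u v.
rewrite !ffunE /=; set S := wreach rk r u :&: wreach rk r v.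
have sepE x : S \subset wreach rk r x -> sep x (a @: S) = S.
  move=> Sx; apply/setP => y; rewrite inE; apply/andP/idP => [[yx /imsetP[z zS ayz]]|yS].
    by rewrite (ainj x y z) //; exact: (subsetP Sx).
  by split; [exact: (subsetP Sx)|exact: imset_f].
rewrite !sepE ?subsetIl ?subsetIr //; apply: tP.
  by apply: leq_trans (RN u); rewrite subset_leq_card ?subsetIl.
by move/(walk_min rk) => [w [wS wu wv]]; rewrite inE wu wv in wS.
Qed.

(** * Centered colorings *)

Section Centered.
Variables (H : sgraph) (rk : H -> nat) (K r q : nat) (a : H -> 'I_K).
Hypothesis aP : forall v w, w \in wreach rk (2 * r * 2 ^ q) v -> w != v -> a w != a v.

Definition radj : rel H := fun x y => (x \in wreach rk r y) || (y \in wreach rk r x).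

Lemma radj_sym : symmetric radj.
Proof. by move=> x y; rewrite /radj orbC. Qed.

Lemma radj_walk k x s : path radj x s -> all (fun y => k <= rk y) (x :: s) ->
  walk (fun y => k <= rk y) (r * size s) x (last x s).
Proof.
elim: s x => [|y s IH] x /=; first by move=> _ /andP[kx _]; exact: walk0.
move=> /andP[xy ps] /and3P[kx ky ks]; rewrite mulnS.
apply: (walk_cat (y := y)); last by apply: IH => //=; rewrite ky.
case/orP: xy => /wreachP w; last by apply: walk_sub w => // z; exact: leq_trans.
by apply: walk_sub (walk_sym w) => // z; exact: leq_trans.
Qed.

(** Both [y] and [w] are joined to the head of [t] by a walk of length at most [r * 2 ^ q], whence
    the radius [2 * r * 2 ^ q]. *)
Lemma sorted_min_wreach t w y : sorted radj t -> size t <= 2 ^ q ->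
  (forall z, z \in t -> rk w <= rk z) -> w \in t -> y \in t -> w \in wreach rk (2 * r * 2 ^ q) y.
Proof.
case: t => [|x s] //= ps ss wmin ws ys; apply/wreachP.
have to z : z \in x :: s -> walk (fun y => rk w <= rk y) (r * size s) x z.
  move=> zs; case/splitPl: zs ps wmin {ss ws ys} => s1 s2 <- {z}; rewrite cat_path => /andP[p1 _] wmin.
  apply: (@walk_sub _ (fun y => rk w <= rk y) _ (r * size s1)) => //.
    by rewrite leq_mul2l size_cat leq_addr orbT.
  apply: radj_walk => //; apply/allP => y' ys'; apply: wmin; rewrite -cat_cons mem_cat.
  by rewrite ys'.
apply: (@walk_sub _ (fun y => rk w <= rk y) _ (r * size s + r * size s)) => //; first by nia.
exact: walk_cat (walk_sym (to y ys)) (to w ws).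
Qed.

(* The minimum of a short walk is weakly reachable from all of it, hence has a
   colour of its own; continue with the longer half. *)
Lemma many_colors k t : sorted radj t -> uniq t -> 2 ^ k <= size t -> size t <= 2 ^ q ->
  k < #|a @: [set x in t]|.
Proof.
elim: k t => [|k IH] t st ut kt tq.
  case: t st ut kt tq => [|x t] // _ _ _ _; apply/card_gt0P; exists (a x); apply: imset_f.
  by rewrite inE mem_head.
have [x0 x0t] : exists x, x \in t.
  by case: (t) kt => [|x s _]; [rewrite leqn0 expn_eq0|exists x; rewrite mem_head].
case: (arg_minnP rk x0t) => w wt wm; have {wm} wmin z : z \in t -> rk w <= rk z by exact: wm.
have wr y : y \in t -> w != y -> a w != a y.
  move=> yt wy; apply: aP => //; exact: (sorted_min_wreach st tq).
suff [t' [st' ut' kt' [tt' wt']]] : exists t', [/\ sorted radj t', uniq t', 2 ^ k <= size t' &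
    {subset t' <= t} /\ w \notin t'].
  have t't : size t' <= size t by exact: uniq_leq_size.
  have := IH t' st' ut' kt' (leq_trans t't tq) => lt; apply: (leq_ltn_trans lt).
  apply: proper_card; apply/properP; split.
    by apply: imsetS; apply/subsetP => x; rewrite !inE; exact: tt'.
  exists (a w); first by apply: imset_f; rewrite inE.
  apply/negP => /imsetP[y]; rewrite inE => yt' awy.
  have [wy|wy] := eqVneq w y; first by rewrite wy yt' in wt'.
  by have := wr y (tt' y yt') wy; rewrite awy eqxx.
case/splitPr: wt st ut kt {tq wmin wr x0t} => t1 t2 st ut kt.
have [s1 _] := cat_sorted2 st.
have s2 : sorted radj t2 by have [_ /=] := cat_sorted2 st; exact: path_sorted.
move: ut; rewrite cat_uniq /= negb_or => /and4P[u1 /andP[w1 _] w2 u2].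
have [k1|k1] := leqP (2 ^ k) (size t1).
  exists t1; split=> //; split=> // x xt; by rewrite mem_cat xt.
exists t2; split=> //; last by split=> // x xt; rewrite mem_cat inE xt !orbT.
by move: kt k1; rewrite size_cat /= expnS; lia.
Qed.

Definition within (Z : {set H}) : rel H := fun x y => [&& x \in Z, y \in Z & radj x y].

Lemma within_sym Z : symmetric (within Z).
Proof. by move=> x y; rewrite /within radj_sym andbCA. Qed.

Definition component (Z : {set H}) z : {set H} := [set y in Z | connect (within Z) z y].

Lemma connect_withinC Z : connect_sym (within Z).
Proof. exact/sym_connect_sym/within_sym. Qed.

(** The least vertex [w] works. If [y] had its colour, a repetition-free path from [w] to [y] with
    at most [2 ^ q] vertices would make [w] weakly reachable from [y]; a longer one would show more
    than [q] colours by [many_colors]. *)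
Lemma component_unique_color (Z : {set H}) z : z \in Z -> #|a @: component Z z| <= q ->
  exists2 w, w \in component Z z & forall y, y \in component Z z -> a y = a w -> y = w.
Proof.
move=> zZ cq; have zC : z \in component Z z by rewrite inE zZ connect0.
case: (arg_minnP rk zC) => w wC wmin; exists w => // y yC ayw; apply: contrapT => yw.
have {}wC : w \in component Z z by exact: wC.
have {}wmin x : x \in component Z z -> rk w <= rk x by exact: wmin.
move: (wC) (yC); rewrite !inE => /andP[wZ zw] /andP[yZ zy].
have /connectP[s0 ps0 ls0] : connect (within Z) w y.
  by apply: connect_trans zy; rewrite connect_withinC.
case/shortenP: ps0 ls0 => s ps us _ ls.
have sC x : x \in w :: s -> x \in component Z z.
  move=> xs; rewrite inE; have wx : connect (within Z) w x.
    case/splitPl: xs ps {us ls} => s1 s2 <-; rewrite cat_path => /andP[p1 _].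
    by apply/connectP; exists s1.
  rewrite (connect_trans zw wx) andbT; case/connectP: wx => t; case/lastP: t => [_ -> //|t x'].
  by rewrite rcons_path last_rcons => /andP[_ /and3P[_ x'Z _]] ->.
have st : sorted radj (w :: s).
  by apply: sub_path ps => x x' /and3P[].
have [le|gt] := leqP (size (w :: s)) (2 ^ q).
  have : w \in wreach rk (2 * r * 2 ^ q) y.
    apply: (sorted_min_wreach st le); last by rewrite ls mem_last.
      by move=> x /sC; exact: wmin.
    exact: mem_head.
  by move/aP => /(_ (introN eqP (nesym yw))); rewrite ayw eqxx.
pose t := take (2 ^ q) (w :: s).
have szt : size t = 2 ^ q by rewrite size_takel // ltnW.
have := @many_colors q t (take_sorted _ st) (take_uniq _ us).
rewrite szt leqnn => /(_ isT isT); rewrite ltnNge => /negP; apply; apply: leq_trans cq.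
apply: subset_leq_card; apply: imsetS; apply/subsetP => x; rewrite inE => /mem_take; exact: sC.
Qed.

End Centered.

(** * Shrub-depth *)

Section ShrubDepth.
Variables (V : finType) (E : rel V).
Hypotheses (Esym : symmetric E) (Eirr : irreflexive E).

(* Tree-models of depth d: adjacency between different classes of comp depends
   only on labels in L. *)
Fixpoint shrub (L : finType) (d : nat) (X : {set V}) : Prop :=
  if d is d'.+1 then
    exists (comp : V -> nat) (mu : V -> L) (Q : L -> L -> bool),
      {in X &, forall u v, comp u <> comp v -> E u v = Q (mu u) (mu v)} /\
      forall z, shrub L d' [set x in X | comp x == z]
  else #|X| <= 1.

Lemma shrub_small (L : finType) d (X : {set V}) (l0 : L) : #|X| <= 1 -> shrub L d X.
Proof.
elim: d X => [//|d IH] X X1; exists (fun=> 0), (fun=> l0), (fun _ _ => true); split=> // z.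
apply: IH; apply: leq_trans X1; apply: subset_leq_card; apply/subsetP => x.
by rewrite inE => /andP[].
Qed.

Fixpoint shrub_color (L : finType) (t d : nat) : finType :=
  if d is d'.+1 then (L * 'I_t.+1 * shrub_color L t d')%type else unit.

(** If [Q m m] holds, one vertex of label [m] from each class of [comp] gives a clique, so at most
    [t] classes contain that label. Indexing them separates adjacent vertices of equal label in
    different classes; the recursion handles a single class. *)
Lemma shrub_coloring (L : finType) t d (X : {set V}) :
  (forall A : {set V}, A \subset X -> {in A &, forall u v, u <> v -> E u v} -> #|A| <= t) ->
  shrub L d X -> exists c : V -> shrub_color L t d, {in X &, forall u v, E u v -> c u <> c v}.
Proof.
elim: d X => [|d IH] X cl /=.
  move=> X1; exists (fun=> tt) => u v uX vX uv _.
  by have := card_le1_eqP X1 u v uX vX => uv'; rewrite uv' Eirr in uv.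
move=> [comp [mu [Q [EQ sX]]]].
have /choice[c cP] : forall z, exists c : V -> shrub_color L t d,
    {in [set x in X | comp x == z] &, forall u v, E u v -> c u <> c v}.
  move=> z; apply: IH (sX z) => A AX; apply: cl; apply: subset_trans AX _.
  by apply/subsetP => x; rewrite inE => /andP[].
pose xs m := [seq x <- enum X | mu x == m].
have xsP m x : (x \in xs m) = (mu x == m) && (x \in X) by rewrite mem_filter mem_enum.
pose cs m := undup [seq comp x | x <- xs m].
have cs_le m : Q m m -> size (cs m) <= t.
  move=> Qm; case E0: (xs m) => [|x0 xs0]; first by rewrite /cs E0.
  pose rep z := nth x0 (xs m) (index z [seq comp x | x <- xs m]).
  have repP z : z \in cs m -> rep z \in xs m /\ comp (rep z) = z.
    rewrite mem_undup => zc; have lt : index z [seq comp x | x <- xs m] < size (xs m).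
      by rewrite -(size_map comp) index_mem.
    by split; [exact: mem_nth|rewrite -(nth_map _ 0) // nth_index].
  have -> : size (cs m) = #|[set x in [seq rep z | z <- cs m]]|.
    rewrite cardsE (card_uniqP _) ?size_map // map_inj_in_uniq ?undup_uniq //.
    by move=> z z' /repP[_ {2}<-] /repP[_ {2}<-] ->.
  apply: cl.
    apply/subsetP => x; rewrite inE => /mapP[z /repP[+ _] ->].
    by rewrite xsP => /andP[].
  move=> u v; rewrite !inE => /mapP[z /repP[+ cz] ->] /mapP[z' /repP[+ cz'] ->].
  rewrite !xsP => /andP[/eqP mz zX] /andP[/eqP mz' zX'] ne.
  by rewrite EQ // ?mz ?mz' // cz cz' => zz; apply: ne; rewrite zz.
pose i x : 'I_t.+1 := if Q (mu x) (mu x) then inord (index (comp x) (cs (mu x))) else ord0.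
exists (fun x => (mu x, i x, c (comp x) x)) => u v uX vX uv [muv iuv cuv].
have [cc|cc] := eqVneq (comp u) (comp v).
  apply: (cP (comp v) u v) => //; rewrite ?inE ?uX ?vX ?cc ?eqxx //.
  by rewrite -{1}cc.
have Qm : Q (mu u) (mu u) by rewrite {2}muv -EQ //; exact/eqP.
move: iuv; rewrite /i -muv Qm => /(congr1 val) /=.
have mem x : x \in X -> mu x = mu u -> comp x \in cs (mu u).
  by move=> xX mx; rewrite mem_undup; apply: map_f; rewrite xsP mx eqxx.
have lt x : x \in X -> mu x = mu u -> index (comp x) (cs (mu u)) < t.+1.
  by move=> xX mx; apply: leq_trans (ltnW _) (cs_le _ Qm); rewrite ?index_mem ?mem.
rewrite !inordK ?lt // => ee; move/eqP: cc; apply.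
by rewrite -(nth_index 0 (mem u uX erefl)) ee nth_index // mem.
Qed.

(** A matching that cannot be extended covers by its end points. Only first ends, and only second
    ends, are kept distinct among themselves. *)
Lemma cover_or_matching (P : rel V) n :
  (exists2 Z : {set V}, #|Z| <= n.*2 & forall u v, P u v -> u \in Z \/ v \in Z) \/
  (exists l : seq (V * V), [/\ size l = n, uniq (map fst l), uniq (map snd l) &
    {in l, forall p, P p.1 p.2}]).
Proof.
elim: n => [|n [[Z Zn Zc]|[l [ln u1 u2 lP]]]]; first by right; exists [::].
  by left; exists Z => //; apply: leq_trans Zn _; rewrite leq_double.
pose Z := [set x in map fst l] :|: [set x in map snd l].
case: (pselect (exists u v, [/\ P u v, u \notin Z & v \notin Z])) => [[u [v [uv uZ vZ]]]|nP].
  right; exists ((u, v) :: l); rewrite /= ln; move: uZ vZ; rewrite !inE !negb_or.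
  move=> /andP[-> _] /andP[_ ->]; split=> // p; rewrite inE => /orP[/eqP -> //|]; exact: lP.
left; exists Z.
  apply: leq_trans (leq_card_setU _ _) _; rewrite !cardsE -addnn.
  by apply: leq_add; apply: leq_trans (card_size _) _; rewrite size_map ln.
move=> u v uv; apply: contrapT => /not_orP[/negP uZ /negP vZ]; apply: nP.
by exists u, v.
Qed.

Definition biclique_free (s : nat) : Prop := forall A B : {set V},
  s <= #|A| -> s <= #|B| -> ~ (forall a b, a \in A -> b \in B -> E a b).

(** Fewer than [s] pairs have their second end in a given class, since such pairs form a biclique by
    themselves. The first ends of [s] pairs meet at most [s] classes; discarding the at most [s * s]
    pairs with second end there leaves [s] pairs, whose second ends complete a biclique. *)
Lemma cross_matching_biclique s (comp : V -> nat) (l : seq (V * V)) :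
  size l = s * s + s -> uniq (map fst l) -> uniq (map snd l) ->
  {in l, forall p, comp p.1 <> comp p.2} ->
  {in l &, forall p q, comp p.1 <> comp q.2 -> E p.1 q.2} -> ~ biclique_free s.
Proof.
move=> sl u1 u2 ne El bf.
have card1 l' : subseq l' l -> #|[set x in map fst l']| = size l'.
  by move=> l'l; rewrite cardsE (card_uniqP _) ?size_map //; apply: subseq_uniq u1; exact: map_subseq.
have card2 l' : subseq l' l -> #|[set x in map snd l']| = size l'.
  by move=> l'l; rewrite cardsE (card_uniqP _) ?size_map //; apply: subseq_uniq u2; exact: map_subseq.
have big l1 l2 : subseq l1 l -> subseq l2 l -> s <= size l1 -> s <= size l2 ->
    {in l1 & l2, forall p q, comp p.1 <> comp q.2} -> False.
  move=> h1 h2 s1 s2 cr; apply: (bf [set x in map fst l1] [set x in map snd l2]).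
  - by rewrite card1.
  - by rewrite card2.
  move=> a b; rewrite !inE => /mapP[p pl ->] /mapP[q ql ->].
  by apply: El; [exact: (mem_subseq h1)|exact: (mem_subseq h2)|exact: cr].
have few2 z : count (fun p => comp p.2 == z) l < s.
  rewrite ltnNge -size_filter; apply/negP => le.
  apply: (big _ _ (filter_subseq _ _) (filter_subseq _ _) le le) => p q.
  rewrite !mem_filter => /andP[/eqP cp pl] /andP[/eqP cq _] e; apply: (ne p pl).
  by rewrite e cq cp.
pose l1 := take s l; pose zs := map (fun p => comp p.1) l1.
pose l2 := [seq p <- l | comp p.2 \notin zs].
have szl1 : size l1 = s by rewrite size_takel // sl leq_addl.
have cz : count (fun p => comp p.2 \in zs) l <= s * s.
  have szz : size zs = s by rewrite size_map.
  rewrite -[X in _ <= X * _]szz.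
  elim: zs {l2 szz} => [|z zs IH]; first by rewrite (eq_count (a2 := pred0)) ?count_pred0.
  rewrite /= mulSn; apply: leq_trans (leq_add (ltnW (few2 z)) IH).
  rewrite -count_predUI; apply: leq_trans (leq_addr _ _).
  by apply: sub_count => p /=; rewrite inE.
apply: (big l1 l2); rewrite ?szl1 //; [exact: take_subseq|exact: filter_subseq| |].
  rewrite size_filter; have := count_predC (fun p => comp p.2 \in zs) l.
  rewrite sl -[count (predC _) l]/(count (fun p => comp p.2 \notin zs) l); lia.
move=> p q pl1; rewrite mem_filter => /andP[qz _] e; move: qz; rewrite -e => /negP; apply.
exact: map_f.
Qed.

(** A vertex ranking of the graph on [X]: any path between distinct vertices of equal rank passes
    through a higher rank. *)
Definition ranking (X : {set V}) (l : V -> nat) : Prop :=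
  {in X &, forall u v, l u = l v ->
    connect (fun x y => [&& x \in X, y \in X, l x <= l u, l y <= l u & E x y]) u v -> u = v}.

Fixpoint shrub_ranks (L : finType) (s d : nat) : nat :=
  if d is d'.+1 then shrub_ranks L s d' + #|{: L * L}| * (s * s + s).*2 else 1.

(** Between different classes, adjacency for a fixed pair of labels is all or nothing, so a large
    matching would give a biclique and few vertices cover these edges. The union [ZZ] of the covers
    gets distinct top ranks; without it every edge stays in one class, and the classes can share
    their ranks. *)
Lemma shrub_ranking (L : finType) s d (X : {set V}) : biclique_free s -> shrub L d X ->
  exists2 l : V -> nat, ranking X l & {in X, forall x, l x < shrub_ranks L s d}.
Proof.
move=> bf; elim: d X => [|d IH] X /=.
  move=> X1; exists (fun=> 0) => // u v uX vX _ _; exact: (card_le1_eqP X1).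
move=> [comp [mu [Q [EQ sX]]]].
have /choice[l lP] : forall z, exists l : V -> nat, ranking [set x in X | comp x == z] l /\
    {in [set x in X | comp x == z], forall x, l x < shrub_ranks L s d}.
  by move=> z; have [l l1 l2] := IH _ (sX z); exists l.
pose P (mm : L * L) : rel V := fun u v =>
  [&& u \in X, v \in X, mu u == mm.1, mu v == mm.2, comp u != comp v & E u v].
have /choice[Z ZP] : forall mm, exists Z : {set V}, #|Z| <= (s * s + s).*2 /\
    forall u v, P mm u v -> u \in Z \/ v \in Z.
  move=> mm; have [[Z Z1 Z2]|[m [sm u1 u2 mP]]] := cover_or_matching (P mm) (s * s + s).
    by exists Z.
  case: (cross_matching_biclique (comp := comp) sm u1 u2 _ _ bf).
    by move=> p /mP /and5P[_ _ _ _ /andP[/eqP]].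
  move=> p q /mP /and5P[p1 p2 /eqP m1 /eqP m2 /andP[/eqP cp Ep]].
  move=> /mP /and5P[q1 q2 /eqP n1 /eqP n2 _] cpq.
  (* [p.1] and [q.2] carry the labels of the cross edge [p], so [Q] gives the same answer for
     them. *)
  by rewrite EQ // m1 n2 -m1 -m2 -EQ.
pose ZZ := \bigcup_mm Z mm.
have cZ : #|ZZ| <= #|{: L * L}| * (s * s + s).*2.
  apply: (@leq_trans (\sum_mm #|Z mm|)).
    rewrite /ZZ; elim/big_rec2: _ => [|x k A _ IH']; first by rewrite cards0.
    by apply: leq_trans (leq_card_setU _ _) _; rewrite leq_add2l.
  by rewrite -sum_nat_const; apply: leq_sum => mm _; have [] := ZP mm.
have same u v : u \in X -> v \in X -> u \notin ZZ -> v \notin ZZ -> E u v -> comp u = comp v.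
  move=> uX vX uZ vZ uv; apply/eqP; apply: contraT => cuv.
  have [_ /(_ u v)] := ZP (mu u, mu v); rewrite /P uX vX !eqxx cuv uv => /(_ isT).
  by case=> h; [case/negP: uZ|case/negP: vZ]; apply/bigcupP; exists (mu u, mu v).
pose K := shrub_ranks L s d.
pose l' x := if x \in ZZ then K + index x (enum ZZ) else l (comp x) x.
have lK x : x \in X -> l (comp x) x < K.
  by move=> xX; have [_] := lP (comp x); apply; rewrite inE xX eqxx.
exists l'; last first.
  move=> x xX; rewrite /l'; case: ifP => xZ; last by apply: leq_trans (lK x xX) _; rewrite leq_addr.
  rewrite ltn_add2l; apply: leq_trans cZ; rewrite cardE index_mem mem_enum //.
have lZ x : x \in X -> (l' x < K) = (x \notin ZZ).
  move=> xX; rewrite /l'; case: ifP => _ /=; last exact: lK.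
  by rewrite ltnNge leq_addr.
move=> u v uX vX luv cuv.
have [uZ|uZ] := boolP (u \in ZZ).
  have vZ : v \in ZZ by rewrite -[_ \in _]negbK -lZ // -luv lZ // negbK.
  move: luv; rewrite /l' uZ vZ => /addnI e.
  by rewrite -(nth_index u (s := enum ZZ) (x := u)) ?mem_enum // e nth_index ?mem_enum.
have vZ : v \notin ZZ by rewrite -lZ // -luv lZ.
have luK : l' u < K by rewrite lZ.
case/connectP: cuv => p pp ev; have [rl _] := lP (comp u).
have inner q x : comp x = comp u -> path (fun x y =>
      [&& x \in X, y \in X, l' x <= l' u, l' y <= l' u & E x y]) x q ->
      path (fun x y => [&& x \in [set x in X | comp x == comp u],
        y \in [set x in X | comp x == comp u], l (comp u) x <= l (comp u) u,
        l (comp u) y <= l (comp u) u & E x y]) x q.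
  elim: q x => [//|y q IHq] x cx /= /andP[/and5P[xX yX lx ly xy] qp].
  have xZ : x \notin ZZ by rewrite -lZ //; exact: leq_ltn_trans lx luK.
  have yZ : y \notin ZZ by rewrite -lZ //; exact: leq_ltn_trans ly luK.
  have cy : comp y = comp u by rewrite -cx; apply/esym/same.
  rewrite IHq // andbT !inE xX yX cx cy eqxx xy /= andbT.
  by move: lx ly; rewrite /l' (negbTE xZ) (negbTE yZ) (negbTE uZ) cx cy => -> ->.
have {}pp := inner p u erefl pp.
have vC : v \in [set x in X | comp x == comp u].
  have uC : u \in [set x in X | comp x == comp u] by rewrite inE uX eqxx.
  rewrite ev; case/lastP: (p) pp => [//|q y]; rewrite rcons_path last_rcons.
  by case/andP => _ /and5P[].
have cv : comp v = comp u by move: vC; rewrite inE => /andP[_ /eqP].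
apply: rl => //; first by rewrite inE uX eqxx.
  by move: luv; rewrite /l' (negbTE uZ) (negbTE vZ) cv.
by apply/connectP; exists p.
Qed.

End ShrubDepth.

(** * Tree-depth *)

Section RankingForest.
Variables (W : sgraph) (l : W -> nat).

Definition below k : rel W := fun x y => [&& l x <= k, l y <= k & sedge x y].

Hypothesis lP : forall u v, l u = l v -> connect (below (l u)) u v -> u = v.

(** The elimination forest of the ranking: [y] is the only vertex of top rank in its component of
    the graph on ranks at most [l y], and it stands above that component. *)
Definition anc x y := connect (below (l y)) x y.

Lemma below_connectC k : connect_sym (below k).
Proof. by apply: sym_connect_sym => x y; rewrite /below sedge_sym andbCA. Qed.

Lemma below_connect_sub k k' : k <= k' -> subrel (connect (below k)) (connect (below k')).
Proof.
move=> kk; apply: connect_sub => x y /and3P[xk yk xy]; apply: connect1.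
by rewrite /below xy (leq_trans xk kk) (leq_trans yk kk).
Qed.

Lemma anc_le x y : anc x y -> l x <= l y.
Proof. by case/connectP => -[_ -> //|z s] /= /andP[/and3P[]]. Qed.

Lemma anc_eq x y : anc x y -> l x = l y -> x = y.
Proof. by move=> xy e; apply: lP => //; rewrite e. Qed.

Lemma anc_lt x y : anc x y -> x != y -> l x < l y.
Proof.
move=> xy ne; rewrite ltn_neqAle anc_le // andbT; apply: contraNneq ne => e.
exact/eqP/anc_eq.
Qed.

Lemma anc_trans x y z : anc x y -> anc y z -> anc x z.
Proof.
move=> xy yz; have le := anc_le yz; apply: connect_trans yz; exact: below_connect_sub le _ _ xy.
Qed.

Lemma anc_chain x y z : anc x y -> anc x z -> l y <= l z -> anc y z.
Proof.
move=> xy xz yz; apply: connect_trans xz; rewrite below_connectC.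
exact: below_connect_sub yz _ _ xy.
Qed.

Definition rank_parent x : option W :=
  [pick y | [&& anc x y, y != x & [forall z, (anc x z && (z != x)) ==> (l y <= l z)]]].

Lemma rank_parentP x y : anc x y -> y != x -> exists p,
  [/\ rank_parent x = Some p, anc x p, l x < l p & l p <= l y].
Proof.
move=> xy yx; have Py : [pred z | anc x z & z != x] y by rewrite /= xy yx.
rewrite /rank_parent; case: pickP => [p /and3P[xp px /forallP pmin]|/(_ _) np].
  exists p; split=> //; first by apply: anc_lt => //; rewrite eq_sym.
  by have := pmin y; rewrite xy yx.
case: (@arg_minnP _ _ [pred z | anc x z & z != x] l Py) => z /andP[xz zx] zmin; have := np z.
rewrite xz zx /= => /negbT/negP; case; apply/forallP => w; apply/implyP; exact: zmin.
Qed.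

Lemma rank_parent_anc x y : rank_parent x = Some y -> anc x y /\ l x < l y.
Proof.
rewrite /rank_parent; case: pickP => // p /and3P[xp px _] [<-]; split=> //.
by apply: anc_lt => //; rewrite eq_sym.
Qed.

Lemma ancestor_anc x y : ancestor_or_self rank_parent x y = anc x y.
Proof.
apply/idP/idP.
  case/connectP => s; elim: s x => [|z s IH] x /=; first by move=> _ ->; exact: connect0.
  by case/andP => /eqP /rank_parent_anc [xz _] ps ly; apply: anc_trans xz (IH _ ps ly).
move: {2}(l y - l x) (leqnn (l y - l x)) => n; elim: n x => [|n IH] x le xy.
  have [->|xy'] := eqVneq x y; first exact: connect0.
  by move: le; rewrite leqn0 subn_eq0 leqNgt anc_lt.
have [->|yx] := eqVneq y x; first exact: connect0.
have [p [px xp lxp lpy]] := rank_parentP xy yx.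
apply: (@connect_trans _ _ p); first by apply: connect1; rewrite px.
by apply: IH; [lia|exact: anc_chain xp xy lpy].
Qed.

Lemma rank_parent_acyclic x y : rank_parent x = Some y -> ~~ ancestor_or_self rank_parent y x.
Proof.
move/rank_parent_anc => [_ lt]; rewrite ancestor_anc; apply/negP => /anc_le.
by rewrite leqNgt lt.
Qed.

(** Ranks strictly increase towards the root, so a root path repeats no rank and hence no value of
    the finer map [c]. *)
Lemma treedepth_le_ranks (T : finType) (c : W -> T) :
  (forall u v, c u = c v -> l u = l v) -> treedepth W <= #|c @: [set: W]|.
Proof.
move=> cl; pose Y := RootedForest rank_parent_acyclic.
have [_ /(_ Y)] := treedepth_attained W; move=> h; apply: leq_trans (h _) _.
  exists id; split=> // u v uv; rewrite /= /closure_edge !ancestor_anc; apply/andP; split.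
    by apply: contraTneq uv => ->; rewrite sedge_irr.
  have [le|/ltnW le] := leqP (l u) (l v); apply/orP; [left|right]; apply: connect1.
    by rewrite /below le leqnn.
  by rewrite /below le leqnn sedge_sym.
apply/bigmax_leqP => x _; set A := [set y | _].
have cinj : {in A &, injective c}.
  move=> y z; rewrite !inE !ancestor_anc => xy xz /cl e; apply: anc_eq => //.
  by apply: anc_chain xy xz _; rewrite e.
by rewrite -(card_in_imset cinj); apply: subset_leq_card; apply: imsetS; exact: subsetT.
Qed.

End RankingForest.

Lemma treedepth_induced_ranking (G : sgraph) (X Y : {set G}) (l : G -> nat) (T : finType)
    (c : G -> T) : ranking (@sedge G) X l -> Y \subset X ->
  {in Y &, forall u v, c u = c v -> l u = l v} -> treedepth (induced Y) <= #|c @: Y|.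
Proof.
move=> rl YX cl.
apply: (@leq_trans #|(fun y : induced Y => c (val y)) @: [set: induced Y]|); last first.
  apply: subset_leq_card; apply/subsetP => _ /imsetP[y _ ->]; apply: imset_f; exact: valP.
apply: (@treedepth_le_ranks (induced Y) (fun y => l (val y))); last first.
  by move=> u v; apply: cl; exact: valP.
move=> u v luv /connectP[s ps ev].
have inX (y : induced Y) : val y \in X by apply: (subsetP YX); exact: valP.
apply/val_inj/rl; rewrite ?inX //; apply/connectP; exists (map val s); last by rewrite last_map ev.
move: ps; rewrite path_map; apply: sub_path => x y /and3P[lx ly xy].
by rewrite /= !inX lx ly.
Qed.

(** * Covers of bounded shrub-depth *)

Section Covers.
Variables (H : sgraph) (rk : H -> nat) (K r q : nat) (a : H -> 'I_K).
Hypothesis aP : forall v w, w \in wreach rk (2 * r * 2 ^ q) v -> w != v -> a w != a v.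
Variables (V : finType) (E : rel V) (emb : V -> H) (L : finType) (lam : H -> L).
Variable Q : L -> L -> {set 'I_K} -> bool.
Hypotheses (Esym : symmetric E) (emb_inj : injective emb).
Hypothesis EQ : forall u v, u != v ->
  E u v = Q (lam (emb u)) (lam (emb v)) (a @: (wreach rk r (emb u) :&: wreach rk r (emb v))).

(** Each removed colour costs two levels: [inl] labels serve the split into components, [inr] labels
    the split at the uniquely coloured vertex. *)
Definition cover_label : finType := (L * {set 'I_K} + bool * bool)%type.

(* D is the set of the uniquely coloured vertices removed so far. Vertices in
   different components of Z only share vertices of D in their reachability sets,
   so the colours in wreach :&: D, added to the labels, determine adjacency. *)
Lemma closed_shrub d (Z D : {set H}) (X : {set V}) : d <= q -> {in D &, injective a} ->
  {in D & Z, forall w z, a w != a z} ->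
  {in X, forall u, emb u \in Z /\ wreach rk r (emb u) \subset Z :|: D} ->
  #|a @: Z| <= d -> shrub E cover_label d.*2 X.
Proof.
pose l0 : cover_label := inr (true, true).
elim: d Z D X => [|d IH] Z D X dq Dinj DZ XZ cZ.
  rewrite /= leqNgt; apply/negP => /ltnW/card_gt0P[u /XZ[uZ _]].
  by move: cZ; rewrite leqn0 cards_eq0 imset_eq0 => /eqP Z0; rewrite Z0 inE in uZ.
have conn u x : u \in X -> x \in Z -> x \in wreach rk r (emb u) -> connect (within rk r Z) (emb u) x.
  move=> uX xZ xu; apply: connect1; have [uZ _] := XZ u uX.
  by rewrite /within uZ xZ /radj xu orbT.
pose rt u := fingraph.root (within rk r Z) (emb u).
have rtE u v : (rt u == rt v) = connect (within rk r Z) (emb u) (emb v).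
  exact/root_connect/connect_withinC.
exists (fun u => enum_rank (rt u) : nat).
exists (fun u => inl (lam (emb u), a @: (wreach rk r (emb u) :&: D))).
exists (fun l l' => if (l, l') is (inl (x, s), inl (x', s')) then Q x x' (s :&: s') else false).
split=> [u v uX vX cuv|z] /=.
  have {}cuv : ~~ connect (within rk r Z) (emb u) (emb v).
    by rewrite -rtE; apply/eqP => e; apply: cuv; rewrite e.
  have uv : u != v by apply: contraNneq cuv => ->; exact: connect0.
  rewrite EQ //; congr Q; apply/setP => c; rewrite in_setI; apply/imsetP/andP.
    move=> [x]; rewrite in_setI => /andP[xu xv] ->.
    have [_ /subsetP/(_ x xu)] := XZ u uX; rewrite in_setU => /orP[xZ|xD].
      case/negP: cuv; apply: connect_trans (conn u x uX xZ xu) _.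
      by rewrite connect_withinC; exact: conn.
    by split; apply: imset_f; rewrite in_setI xD ?xu ?xv.
  move=> [/imsetP[x + ->] /imsetP[y + axy]]; rewrite !in_setI => /andP[xu xD] /andP[yv yD].
  by exists x => //; rewrite in_setI xu (Dinj x y).
set Xz := [set x in X | _].
change (shrub E cover_label d.*2.+1 Xz).
have [->|[u0 u0z]] := set_0Vmem Xz.
  by apply: (shrub_small _ _ l0); rewrite cards0.
have XzX u : u \in Xz -> u \in X by rewrite inE => /andP[].
have u0Z : emb u0 \in Z by have [] := XZ u0 (XzX _ u0z).
pose C := component rk r Z (emb u0).
have CZ x : x \in C -> x \in Z by rewrite inE => /andP[].
have cC : #|a @: C| <= q.
  by apply: leq_trans dq; apply: leq_trans cZ; apply/subset_leq_card/imsetS/subsetP.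
have [w wC wuniq] := component_unique_color aP u0Z cC.
have XzC u : u \in Xz -> emb u \in C.
  move=> uz; have [uZ _] := XZ u (XzX u uz); rewrite inE uZ -rtE /=.
  move: u0z uz; rewrite !inE => /andP[_ /eqP <-] /andP[_ /eqP e].
  by apply/eqP/enum_rank_inj/val_inj; rewrite /= e.
(* At most one vertex of [V] is sent to [w]; the label of any other vertex tells whether it is
   adjacent to that one. *)
exists (fun u => emb u == w : nat).
exists (fun u => inr (emb u == w, [exists u1, (emb u1 == w) && E u1 u])).
exists (fun l l' => if (l, l') is (inr (b, e), inr (_, e')) then if b then e' else e else false).
have toroot u v : emb u = w -> E u v = [exists u1, (emb u1 == w) && E u1 v].
  move=> uw; apply/idP/existsP => [uv|[u1 /andP[/eqP u1w]]].
    by exists u; rewrite uw eqxx.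
  by rewrite (emb_inj (etrans u1w (esym uw))).
split=> [u v uz vz cuv|z'] /=.
  case: eqP cuv => [uw _|uw]; first exact: toroot.
  by case: eqP => // vw _; rewrite Esym; exact: toroot.
case: z' => [|z']; last first.
  apply: (shrub_small _ _ l0).
  apply/card_le1_eqP => u v; rewrite !inE => /andP[_ uw] /andP[_ vw]; apply: emb_inj.
  by case: (emb u =P w) uw => // -> _; case: (emb v =P w) vw.
apply: (IH (C :\ w) (w |: D)); first exact: ltnW.
- move=> x y; rewrite !inE => /orP[/eqP ->|xD] /orP[/eqP ->|yD] // axy.
  + by have := DZ y w yD (CZ w wC); rewrite axy eqxx.
  + by have := DZ x w xD (CZ w wC); rewrite axy eqxx.
  + exact: Dinj.
- move=> x y xD /setD1P[yw yC].
  case/setU1P: xD => [->|xD]; last exact/DZ/CZ.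
  by apply: contraNneq yw => e; apply/eqP/wuniq.
- move=> u; rewrite inE => /andP[uz uw].
  have {}uw : emb u != w by case: (emb u =P w) uw.
  have uC := XzC u uz; split; first by rewrite in_setD1 uw.
  have [uZ Ru] := XZ u (XzX u uz); apply/subsetP => x xu.
  have := subsetP Ru x xu; rewrite in_setU => /orP[xZ|xD]; last by rewrite !in_setU xD !orbT.
  have [xw|xw] := eqVneq x w; first by rewrite in_setU in_setU1 xw eqxx orbT.
  rewrite in_setU in_setD1 xw /= inE xZ /=; apply/orP; left.
  move: uC; rewrite inE => /andP[_ h]; apply: connect_trans h _.
  exact: conn (XzX u uz) xZ xu.
rewrite -ltnS; apply: leq_trans cZ; apply: proper_card; apply/properP; split.
  by apply: imsetS; apply/subsetP => x /setD1P[_]; exact: CZ.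
exists (a w); first by apply: imset_f; exact: CZ.
by apply/negP => /imsetP[y /setD1P[yw yC] e]; move/eqP: yw; apply; exact: wuniq.
Qed.

End Covers.

Lemma shrub_covers (D : graph_class) p : structurally_bounded_expansion D ->
  exists (L K : finType) (d : nat), forall G, D G -> exists c : G -> K,
    forall I : {set K}, #|I| <= p -> shrub (@sedge G) L d [set x | c x \in I].
Proof.
move=> [C [beC [T TP]]]; have [dn sp] := bounded_expansion_sparse beC.
have [r rP] := formula_normal_form (Defs.eta T); have [b bP] := wreach_order dn.
(* [N] bounds the [r]-reachability sets, so [p] cover colours involve at most [q] values of [a]; [m]
   is the radius at which [a] is centered for [q] colours. *)
pose N := b r; pose q := p * N; pose m := 2 * r * 2 ^ q; pose K := (b m).+1.
have [L LP] := rP N K.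
exists (cover_label K L), {set 'I_K}, q.*2 => G /TP[H [M [CH [phi [phib phiE]]]]].
have [rk rinj rkP] := bP r m H (sp H CH).
have [a aP] : exists a : H -> 'I_K, forall v w, w \in wreach rk m v -> w != v -> a w != a v.
  apply: (@greedy_coloring H rk (wreach rk m)) => // [v w|v]; first exact: wreach_le.
  by have [] := rkP v.
have rm : r + r <= m.
  have : 0 < 2 ^ q by rewrite expn_gt0.
  by rewrite /m; nia.
(* Two vertices weakly [r]-reachable from [v] are joined through [v] by a walk of length
   [r + r <= m], so the smaller is weakly [m]-reachable from the larger. *)
have ainj v : {in wreach rk r v &, injective a}.
  suff lt x y : x \in wreach rk r v -> y \in wreach rk r v -> rk x < rk y -> a x != a y.
    move=> x y xv yv axy; apply: rinj; apply/eqP; rewrite eqn_leq.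
    by apply/andP; split; rewrite leqNgt; apply/negP => /lt; [move=> /(_ yv xv)|move=> /(_ xv yv)];
      rewrite axy eqxx.
  move=> xv yv xy; apply: aP; last by apply: contraTneq xy => ->; rewrite ltnn.
  apply/wreachP; apply: (@walk_sub _ (fun z => rk x <= rk z) _ (r + r)) => //.
  apply: (@walk_cat _ _ _ _ _ v); last exact/wreachP.
  by move/wreachP: yv => /walk_sym; apply: walk_sub => // z; apply: leq_trans (ltnW xy).
have [|lam [Q QP]] := LP H M rk a _ ainj; first by move=> v; have [] := rkP v.
pose emb x := val (phi x).
have emb_inj : injective emb by apply: inj_comp; [exact: val_inj|exact: bij_inj].
have EQ u v : u != v -> sedge u v =
    Q (lam (emb u)) (lam (emb v)) (a @: (wreach rk r (emb u) :&: wreach rk r (emb v))).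
  move=> uv; rewrite -phiE -QP /= /transduced_edge.
  by rewrite (inj_eq (bij_inj phib)) uv.
exists (fun x => a @: wreach rk r (emb x)) => I Ip; set X := [set x | _].
pose Z := \bigcup_(x in X) wreach rk r (emb x).
apply: (@closed_shrub H rk K r q a aP G (@sedge G) emb L lam Q _ emb_inj EQ q Z set0) => //.
- exact: sedge_sym.
- by move=> x y; rewrite inE.
- by move=> x y; rewrite inE.
- move=> u uX; split; first by apply/bigcupP; exists u => //; exact: wreach_self.
  by rewrite setU0; apply: bigcup_sup uX.
(* Members of [I] with more than [N] elements are no vertex's colour and may be dropped. *)
have sub : a @: Z \subset \bigcup_(A in I | #|A| <= N) A.
  apply/subsetP => _ /imsetP[y /bigcupP[x xX yx] ->]; apply/bigcupP.
  exists (a @: wreach rk r (emb x)); last exact: imset_f.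
  move: xX; rewrite inE => -> /=; apply: leq_trans (leq_imset_card _ _) _.
  by have [] := rkP (emb x).
apply: leq_trans (subset_leq_card sub) _.
apply: (@leq_trans (\sum_(A in I | #|A| <= N) #|A|)).
  elim/big_rec2: _ => [|x k A _ IH']; first by rewrite cards0.
  by apply: leq_trans (leq_card_setU _ _) _; rewrite leq_add2l.
apply: (@leq_trans (\sum_(A in I) N)); last by rewrite sum_nat_const leq_mul2r Ip orbT.
rewrite big_mkcondr; apply: leq_sum => A _; by case: ifP.
Qed.

(** * Topological minors and the theorem *)

(** By [TM_omega_le] the clique numbers are bounded, so the supremum is a maximum and not the
    default 0. *)
Lemma TM_omega_ge r (G H : sgraph) : TM r G H -> omega H <= omega_class (TM r G).
Proof.
move=> GH; apply: (@classical_sets.ge_supremum_Nmem _ nat); last by exists H.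
pose A n := `[< exists2 H' : sgraph, TM r G H' & omega H' = n >].
have exA : exists n, A n by exists (omega H); apply/asboolP; exists H.
have ubA n : A n -> n <= #|G| by move/asboolP => [H' GH' <-]; exact: TM_omega_le GH'.
case: (ex_maxnP exA ubA) => n /asboolP An nmax; exists n; split=> [k [H' GH' <-]|k].
  by apply: nmax; apply/asboolP; exists H'.
by apply.
Qed.

Lemma TM_self r G : TM r G G.
Proof.
exists (fun _ _ => ord0), (fun x => match x with inl u => u | inr t => (val t).1.1 end).
have noinr (t : {t : G * G * 'I_r | oriented_edge t.1.1 t.1.2 && (t.2 < (ord0 : 'I_r.+1))}) : False.
  by have := valP t; rewrite /= ltn0 andbF.
split=> [[u|t] [v|t'] /=|[u|t] [v|t']]; try by case: (noinr t) || case: (noinr t').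
  by move->.
by case/orP => /andP[/andP[+ _] _]; rewrite // sedge_sym.
Qed.

Section Complete.
Variable t : nat.

Lemma complete_sym : symmetric (fun x y : 'I_t => x != y).
Proof. by move=> x y; rewrite eq_sym. Qed.

Lemma complete_irr : irreflexive (fun x y : 'I_t => x != y).
Proof. by move=> x; rewrite eqxx. Qed.

Definition complete : sgraph := SGraph complete_sym complete_irr.

Lemma omega_complete : t <= omega complete.
Proof.
have cl : clique [set: complete].
  by apply/forall_inP => x _; apply/forall_inP => y _; apply/implyP.
by apply: leq_trans (leq_bigmax_cond _ cl); rewrite cardsT card_ord.
Qed.

(** Branch vertices go to [A], subdivision vertices to [B], where each ordered pair has a place
    reserved; irreflexivity keeps [A] and [B] disjoint. *)
Lemma biclique_TM r (G : sgraph) (A B : {set G}) : 0 < r -> t <= #|A| -> t * t <= #|B| ->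
  (forall x y, x \in A -> y \in B -> sedge x y) -> TM r G complete.
Proof.
move=> r0 tA tB AB.
have tB' : #|{: 'I_t * 'I_t}| <= #|B| by rewrite card_prod card_ord.
have i1 : (inord 1 : 'I_r.+1) = 1 :> nat by rewrite inordK.
exists (fun _ _ => inord 1).
pose f (x : subdivision_vertex (fun _ _ : complete => inord 1 : 'I_r.+1)) : G := match x with
  | inl u => enum_val (widen_ord tA u)
  | inr s => enum_val (widen_ord tB' (enum_rank (val s).1)) end.
have one (s : {s : complete * complete * 'I_r |
    oriented_edge s.1.1 s.1.2 && (s.2 < (inord 1 : 'I_r.+1))}) : (val s).2 = 0 :> nat.
  have /andP[_ lt] := valP s; have := leq_trans lt (eq_leq i1).
  by rewrite ltnS leqn0 => /eqP.
have fA u : f (inl u) \in A by exact: enum_valP.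
have fB s : f (inr s) \in B by exact: enum_valP.
have AnB x : x \in A -> x \in B -> False.
  by move=> xA xB; have := AB x x xA xB; rewrite sedge_irr.
exists f; split=> [[u|s] [v|s']|[u|s] [v|s']].
- by move=> /enum_val_inj /(congr1 val) /= uv; congr inl; exact: val_inj.
- by move=> e; case: (AnB _ (fA u)); rewrite e.
- by move=> e; case: (AnB _ (fA v)); rewrite -e.
- move=> /enum_val_inj /(congr1 val) /= e; congr inr; apply/val_inj.
  have {}e : (val s).1 = (val s').1 by apply/enum_rank_inj/val_inj.
  by rewrite [LHS]surjective_pairing [RHS]surjective_pairing e; congr pair; apply: val_inj; rewrite /= !one.
- by case/orP => /andP[_ /eqP e]; move: (etrans (esym i1) e).
- by move=> _; exact: AB.
- by move=> _; rewrite sedge_sym; exact: AB.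
- by case/orP => /andP[_]; rewrite !one.
Qed.

End Complete.

(** Testing vertex sets instead of colour sets disposes of colours in [I] that do not occur. *)
Lemma chi_le p (G : sgraph) (F : finType) (c : G -> F) :
  (forall Y : {set G}, #|c @: Y| <= p -> treedepth (induced Y) <= #|c @: Y|) -> chi p G <= #|F|.
Proof.
move=> cP; have [_ mG] := chi_attained p G; apply: (mG _ (fun x => enum_rank (c x))) => I Ip.
set Y := [set x | _]; have cY : #|c @: Y| <= #|I|.
  rewrite -(card_imset _ (@enum_rank_inj F)) -imset_comp; apply: subset_leq_card.
  by apply/subsetP => _ /imsetP[x + ->]; rewrite inE.
exact: leq_trans (cP Y (leq_trans cY Ip)) cY.
Qed.

Lemma omega_clique (G : sgraph) (A : {set G}) :
  {in A &, forall u v, u <> v -> sedge u v} -> #|A| <= omega G.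
Proof.
move=> cl; apply: leq_bigmax_cond; apply/forall_inP => x xA; apply/forall_inP => y yA.
by apply/implyP => /eqP; exact: cl.
Qed.

Theorem proposition3 (D : graph_class) (hD : structurally_bounded_expansion D)
    (p : nat) (hp : 0 < p) : weakly_chi_bounded p D.
Proof.
have [L [K [d cov]]] := shrub_covers p hD.
suff /choice[g gP] : forall t, exists B, forall G, D G -> omega_class (TM p.-1 G) = t -> chi p G <= B.
  by exists g => G DG; exact: gP.
move=> t; case: p hp cov => [//|[|p]] _ cov /=.
  exists #|{: K * shrub_color L t d}| => G DG et; have [c cP] := cov G DG.
  have /choice[l lP] : forall k, exists l : G -> shrub_color L t d,
      {in [set x | c x \in [set k]] &, forall u v, sedge u v -> l u <> l v}.
    move=> k; apply: (@shrub_coloring _ _ (@sedge_irr G)); last by apply: cP; rewrite cards1.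
    move=> A _ cl; apply: leq_trans (omega_clique cl) _; rewrite -et; exact/TM_omega_ge/TM_self.
  apply: (@chi_le _ _ _ (fun x => (c x, l (c x) x))) => Y Y1.
  (* A set with one colour spans no edge, so the constant rank 0 is a ranking. *)
  apply: (@treedepth_induced_ranking G Y Y (fun=> 0)) => // u v uY vY _.
  move=> /connectP[[//|w s] /= /andP[/and3P[_ wY uw] _] _].
  have /card_le1_eqP/(_ _ _ (imset_f _ uY) (imset_f _ wY)) [cuw luw] := Y1.
  case: (lP (c w) u w) => //; rewrite ?inE ?cuw ?eqxx //.
  by rewrite -luw cuw.
(* The sum dominates both the [t.+1] branch vertices and the [t.+1 * t.+1] places for subdivision
   vertices. *)
pose s := t.+1 * t.+1 + t.+1; pose k := shrub_ranks L s d.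
exists #|{: K * {ffun {set K} -> 'I_k.+1}}| => G DG et; have [c cP] := cov G DG.
have bf : biclique_free (@sedge G) s.
  move=> A B sA sB AB; suff : t.+1 <= t by rewrite ltnn.
  rewrite -{2}et; apply: leq_trans (omega_complete _) _; apply: TM_omega_ge.
  apply: biclique_TM AB => //; [apply: leq_trans sA|apply: leq_trans sB]; rewrite /s; lia.
have /choice[l lP] : forall I : {set K}, exists l : G -> nat, #|I| <= p.+2 ->
    ranking (@sedge G) [set x | c x \in I] l /\ {in [set x | c x \in I], forall x, l x < k}.
  move=> I; have [Ip|Ip] := leqP #|I| p.+2; last by exists (fun=> 0).
  by have [l l1 l2] := shrub_ranking bf (cP I Ip); exists l.
(* With ranks for all [I] in the colour, equal colours on [Y] give equal ranks for the set of cover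
   colours that occur on [Y]. *)
pose col x := (c x, [ffun I => inord (l I x) : 'I_k.+1]).
apply: (@chi_le _ _ _ col) => Y Yp; pose I := c @: Y.
have Ip : #|I| <= p.+2.
  apply: leq_trans Yp; rewrite -[I]/((fst \o col) @: Y) imset_comp; exact: leq_imset_card.
have [rI lI] := lP I Ip.
have YI : Y \subset [set x | c x \in I] by apply/subsetP => x xY; rewrite inE imset_f.
apply: (treedepth_induced_ranking rI YI) => u v uY vY [_] /ffunP/(_ I); rewrite !ffunE.
have lt x : x \in Y -> l I x < k.+1 by move=> xY; apply/ltnW/lI/(subsetP YI).
by move/(congr1 val); rewrite /= !inordK ?lt.
Qed.
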